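(* Let $m,n$ be positive integers and $c=\gcd(m,n)$. Then the Hermitian form $\eta$ on $\mathrm{Rep}(T_{m,n},\mathbb{E}_p)$ satisfies $\operatorname{rank}\eta=\nu'_h(T_{m,n})$, except perhaps if all three of the following hold: $q\mid\frac{mn}{c}$, $p\nmid mn$, and $4\mid\operatorname{ord}_c(p)$.
   Context: Let $p$ be a prime, and let $\mathbb{F}_p\subset\mathbb{E}_p$ be the finite fields with $p$ and $p^2$ elements. For $x\in\mathbb{E}_p$, $\bar x$ is the conjugate of $x$ over $\mathbb{F}_p$. Fix $\theta\in\mathbb{E}_p$ with $\mathbb{E}_p=\mathbb{F}_p(\theta)$ and $\theta\bar\theta=1$; its minimal polynomial over $\mathbb{F}_p$ is $h=t^2+\kappa t+1$. Let $q$ be the order of $\theta$ in $\mathbb{E}_p^\times$. Fix a non-zero $\mathfrak{i}\in\mathbb{E}_p$ with $\bar{\mathfrak{i}}=-\mathfrak{i}$. Let $\Lambda_p=\mathbb{F}_p[t,t^{-1}]$, and make $\mathbb{E}_p$ a $\Lambda_p$-module by $tx=\theta x$. Let $K$ be an oriented link in $S^3$ with diagram $D$. At each crossing $c$ let $\omega(c)$ be the overcrossing arc, $\lambda(c)$ the undercrossing arc to the left of $\omega(c)$, $\rho(c)$ the undercrossing arc to the right of $\omega(c)$, and $\mathrm{sign}(c)=\pm1$ the sign of the crossing. The Alexander module $A_p(K)$ is the $\Lambda_p$-module generated by the arcs of $D$ with one relation $\lambda(c)=t\rho(c)+(1-t)\omega(c)$ for each crossing $c$. Let $\nu'_h(K)$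 be the number of factors isomorphic to $\Lambda_p/(h)$ in the primary decomposition of $A_p(K)$. Put $\mathrm{Rep}(K,\mathbb{E}_p)=\mathrm{Hom}_{\Lambda_p}(A_p(K),\mathbb{E}_p)$, a vector space over $\mathbb{E}_p$, and define the Hermitian form $\eta$ on it by $\eta(f,g)=\sum_c \mathrm{sign}(c)\,\mathfrak{i}\bigl(f\rho(c)\overline{g\omega(c)}-f\omega(c)\overline{g\rho(c)}\bigr)$, the sum being over all crossings of $D$. $T_{m,n}$ denotes the $(m,n)$ torus link, oriented as the closure of the $m$-string braid $(\sigma_{m-1}\sigma_{m-2}\cdots\sigma_1)^n$ (all strings oriented in the same direction, all crossings positive). For coprime integers $a,b$, $\operatorname{ord}_a(b)$ is the order of $b$ in $(\mathbb{Z}/a)^\times$. *)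

(* Defs.v *)
From HB Require Import structures.
From mathcomp Require Import all_boot all_order all_algebra.
From mathcomp Require Import all_field.
From mathcomp Require cyclic.
From mathcomp Require Import boolp classical_sets.
From mathcomp Require Import ring.

Set Implicit Arguments.
Unset Strict Implicit.
Unset Printing Implicit Defensive.

Import GRing.Theory.
Local Open Scope ring_scope.

(* The ring F[t, t^-1] of Laurent polynomials, as the subring of the field of
   rational functions F(t) formed by the P / t^n. *)
Section Laurent.
Variable F : fieldType.

Definition is_laurent (x : {fraction {poly F}}) : bool :=
  `[< exists (P : {poly F}) (n : nat),
        x = FracField.tofrac P / FracField.tofrac 'X ^+ n >].

Lemma tofracX_neq0 n : (FracField.tofrac 'X : {fraction {poly F}}) ^+ n != 0.
Proof. by rewrite expf_neq0 // tofrac_eq0 polyX_eq0. Qed.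

Lemma is_laurentP x :
  reflect (exists (P : {poly F}) (n : nat),
             x * FracField.tofrac 'X ^+ n = FracField.tofrac P)
          (is_laurent x).
Proof.
apply: (iffP (asboolP _)) => -[P [n xE]]; exists P, n.
  by rewrite xE divfK // tofracX_neq0.
by rewrite -xE mulfK // tofracX_neq0.
Qed.

Lemma is_laurent_subring : subring_closed is_laurent.
Proof.
split=> [|x y /is_laurentP[P [m xE]] /is_laurentP[Q [n yE]]
         |x y /is_laurentP[P [m xE]] /is_laurentP[Q [n yE]]].
- by apply/is_laurentP; exists 1, 0; rewrite mulr1 tofrac1.
- apply/is_laurentP; exists (P * 'X^n - Q * 'X^m), (m + n)%N.
  rewrite tofracB !tofracM !tofracXn -xE -yE mulrBl exprD.
  by rewrite mulrA [y * _]mulrA [y * _ * _]mulrAC.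
- apply/is_laurentP; exists (P * Q), (m + n)%N.
  by rewrite tofracM -xE -yE exprD mulrACA.
Qed.

HB.instance Definition _ :=
  GRing.isSubringClosed.Build {fraction {poly F}} is_laurent
    is_laurent_subring.

Record laurent :=
  Laurent { laurent_val :> {fraction {poly F}}; _ : is_laurent laurent_val }.

HB.instance Definition _ := [isSub for laurent_val].
HB.instance Definition _ := [Choice of laurent by <:].
HB.instance Definition _ := [SubChoice_isSubComNzRing of laurent by <:].

Lemma is_laurent_tofrac P : is_laurent (FracField.tofrac P).
Proof. by apply/is_laurentP; exists P, 0; rewrite mulr1. Qed.

Definition laurent_of_poly (P : {poly F}) : laurent :=
  Laurent (is_laurent_tofrac P).

Definition laurent_t : laurent := laurent_of_poly 'X.

Lemma laurent_fracP (x : laurent) :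
  {Pn : {poly F} * nat |
    laurent_val x * FracField.tofrac 'X ^+ Pn.2 = FracField.tofrac Pn.1}.
Proof.
case: x => x /= /is_laurentP xP; apply: cid.
by case: xP => P [n xE]; exists (P, n).
Qed.

(* The evaluation P / t^n |-> P(theta) / theta^n; it is a ring morphism because
   theta is invertible, and makes E into an F[t, t^-1]-module on which t acts
   as theta. *)
Definition laurent_eval (E : fieldExtType F) (theta : E)
    (theta_neq0 : theta != 0) (x : laurent) : E :=
  let: (P, n) := sval (laurent_fracP x) in horner_alg theta P / theta ^+ n.

Section Eval.
Variables (E : fieldExtType F) (theta : E) (theta_neq0 : theta != 0).
Local Notation ev := (laurent_eval theta_neq0).

Lemma laurent_evalE (x : laurent) P n :
  laurent_val x * FracField.tofrac 'X ^+ n = FracField.tofrac P ->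
  ev x * theta ^+ n = horner_alg theta P.
Proof.
rewrite /laurent_eval; case: (laurent_fracP x) => -[Q k] /= xQ xP.
have /eqP : FracField.tofrac (Q * 'X^n) = FracField.tofrac (P * 'X^k).
  by rewrite !tofracM !tofracXn -xQ -xP mulrAC.
rewrite tofrac_eq => /eqP/(congr1 (horner_alg theta)).
rewrite !rmorphM /= !rmorphXn /= horner_algX => QP.
apply: (mulIf (expf_neq0 k theta_neq0)).
by rewrite mulrAC divfK ?expf_neq0.
Qed.

Lemma laurent_eval_zmod : zmod_morphism ev.
Proof.
move=> x y; case: (laurent_fracP x) => -[P m] /= xP.
case: (laurent_fracP y) => -[Q n] /= yQ.
have evx := laurent_evalE xP; have evy := laurent_evalE yQ.
apply: (mulIf (expf_neq0 (m + n) theta_neq0)).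
have xyE : laurent_val (x - y) * FracField.tofrac 'X ^+ (m + n)
    = FracField.tofrac (P * 'X^n - Q * 'X^m).
  rewrite tofracB !tofracM !tofracXn -xP -yQ /= mulrBl exprD.
  by congr (_ - _); rewrite mulrA; [|rewrite mulrAC].
rewrite (laurent_evalE xyE) rmorphB !rmorphM /= !rmorphXn /= horner_algX.
rewrite -evx -evy mulrBl exprD.
by congr (_ - _); rewrite mulrA; [|rewrite mulrAC].
Qed.

Lemma laurent_eval_monoid : monoid_morphism ev.
Proof.
split=> [|x y].
  have oneE : laurent_val 1 * FracField.tofrac 'X ^+ 0 = FracField.tofrac 1.
    by rewrite mulr1 tofrac1.
  by have := laurent_evalE oneE; rewrite mulr1 rmorph1.
case: (laurent_fracP x) => -[P m] /= xP.
case: (laurent_fracP y) => -[Q n] /= yQ.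
have evx := laurent_evalE xP; have evy := laurent_evalE yQ.
apply: (mulIf (expf_neq0 (m + n) theta_neq0)).
have xyE : laurent_val (x * y) * FracField.tofrac 'X ^+ (m + n)
    = FracField.tofrac (P * Q).
  by rewrite tofracM -xP -yQ /= exprD mulrACA.
by rewrite (laurent_evalE xyE) rmorphM /= -evx -evy exprD mulrACA.
Qed.

HB.instance Definition _ :=
  GRing.isZmodMorphism.Build laurent E ev laurent_eval_zmod.
HB.instance Definition _ :=
  GRing.isMonoidMorphism.Build laurent E ev laurent_eval_monoid.

Lemma laurent_eval_t : ev laurent_t = theta.
Proof.
have tE : laurent_val laurent_t * FracField.tofrac 'X ^+ 0
    = FracField.tofrac 'X by rewrite mulr1.
by have := laurent_evalE tE; rewrite mulr1 horner_algX.
Qed.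

End Eval.
End Laurent.

(* The quotient of a module by the submodule spanned by a finite family. *)
Section SpanQuotient.
Variables (R : comNzRingType) (V : lmodType R) (I : finType) (v : I -> V).

Definition in_span : {pred V} := fun x =>
  `[< exists c : I -> R, x = \sum_i c i *: v i >].

Lemma in_span_submod : submod_closed in_span.
Proof.
split=> [|a x y /asboolP[c ->] /asboolP[d ->]].
  by apply/asboolP; exists (fun=> 0); rewrite big1 // => i _; rewrite scale0r.
apply/asboolP; exists (fun i => a * c i + d i).
rewrite scaler_sumr -big_split /=; apply: eq_bigr => i _.
by rewrite scalerDl scalerA.
Qed.

HB.instance Definition _ :=
  GRing.isSubmodClosed.Build R V in_span in_span_submod.

Definition span_quot := Quotient.quot (in_span : zmodClosed V).
HB.instance Definition _ := GRing.Zmodule.on span_quot.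

Definition span_pi (x : V) : span_quot := (\pi_(Quotient.quot (in_span : zmodClosed V)) x)%qT.

Lemma span_piP x y : reflect (span_pi x = span_pi y) (in_span (x - y)).
Proof.
apply: (iffP idP) => [xy|/eqP].
  by apply/eqP; rewrite -[_ == _]Quotient.idealrBE.
by rewrite -[_ == _]Quotient.idealrBE.
Qed.

Lemma span_piK (x : span_quot) : span_pi (repr x) = x.
Proof. exact: reprK. Qed.

Lemma span_piB : zmod_morphism span_pi.
Proof. exact: raddfB. Qed.

Definition span_scale (a : R) (x : span_quot) : span_quot :=
  span_pi (a *: repr x).

Lemma span_scale_pi a x : span_scale a (span_pi x) = span_pi (a *: x).
Proof.
apply/span_piP; rewrite -scalerBr.
by apply: (@rpredZ _ _ in_span); apply/span_piP; rewrite span_piK.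
Qed.

HB.instance Definition _ :=
  GRing.isZmodMorphism.Build V span_quot span_pi span_piB.

Lemma span_scaleA a b x : span_scale a (span_scale b x) = span_scale (a * b) x.
Proof. by rewrite -[x]span_piK !span_scale_pi scalerA. Qed.

Lemma span_scale1 : left_id 1 span_scale.
Proof. by move=> x; rewrite -[x]span_piK !span_scale_pi scale1r. Qed.

Lemma span_scaleDr : right_distributive span_scale +%R.
Proof.
move=> a x y; rewrite -[x]span_piK -[y]span_piK -raddfD !span_scale_pi.
by rewrite scalerDr raddfD.
Qed.

Lemma span_scaleDl x : {morph span_scale^~ x : a b / a + b}.
Proof. by move=> a b; rewrite -[x]span_piK !span_scale_pi scalerDl raddfD. Qed.

HB.instance Definition _ := GRing.Zmodule_isLmodule.Build R span_quot
  span_scaleA span_scale1 span_scaleDr span_scaleDl.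

Lemma span_pi_scalable : scalable span_pi.
Proof. by move=> a x; rewrite -span_scale_pi. Qed.

HB.instance Definition _ :=
  GRing.isScalable.Build R V span_quot *:%R span_pi span_pi_scalable.

End SpanQuotient.

Section PrimaryDecomposition.
Variable R : comNzRingType.

Definition cyclic_module (a : R) := span_quot (fun _ : unit => a : R^o).

Definition lmod_isomorphic (U V : lmodType R) : Prop :=
  exists f : {linear U -> V}, bijective f.

Definition invertible (a : R) : Prop := exists b, a * b = 1.

Definition irreducible (a : R) : Prop :=
  [/\ a <> 0, ~ invertible a
    & forall b c, a = b * c -> invertible b \/ invertible c].

(* The direct sum of R^r and of the R / (pi^e), for (pi, e) in s. *)
Fixpoint primary_sum (r : nat) (s : seq (R * nat)) : lmodType R :=
  if s is (pi, e) :: s' then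
    (cyclic_module (pi ^+ e) * primary_sum r s')%type
  else 'rV[R]_r.

Definition primary_decomposition (M : lmodType R) r (s : seq (R * nat)) : Prop :=
  (forall pi e, (pi, e) \in s -> irreducible pi /\ (0 < e)%N) /\
  lmod_isomorphic M (primary_sum r s).

(* The number of factors isomorphic to R / (h) in the primary decomposition
   of M.  The value 0 taken when M has no primary decomposition is irrelevant
   when R is a principal ideal domain and M is finitely generated. *)
Definition primary_multiplicity (M : lmodType R) (h : R) : nat :=
  xget 0%N (fun k => exists r s, primary_decomposition M r s /\
    k = count (fun pe => `[< lmod_isomorphic (cyclic_module (pe.1 ^+ pe.2))
                                             (cyclic_module h) >]) s).

End PrimaryDecomposition.

(* The part of an oriented link diagram seen by the Alexander module and by
   the form eta. *)
Record diagram := Diagram {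
  arc : finType;
  crossing : finType;
  omega : crossing -> arc;   (* overcrossing arc *)
  lambda : crossing -> arc;  (* undercrossing arc to the left of omega *)
  rho : crossing -> arc;     (* undercrossing arc to the right of omega *)
  positive : crossing -> bool
}.

(* Closed braids.  Strings are oriented upwards, and the letters of a word are
   read from bottom to top.  The letter (i, true) is the generator sigma_(i+1):
   the string in position i passes over the string in position i+1 (counting
   positions from 0, left to right), which is a positive crossing.  The letter
   (i, false) is its inverse. *)
Section ClosedBraid.
Variables (m : nat) (w : seq ('I_m.-1 * bool)).

Definition low (i : 'I_m.-1) : 'I_m := widen_ord (leq_pred m) i.
Definition high (i : 'I_m.-1) : 'I_m :=
  Ordinal (etrans (esym (ltn_predRL i m)) (ltn_ord i)).

Definition over_in (l : 'I_m.-1 * bool) := if l.2 then low l.1 else high l.1.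
Definition over_out (l : 'I_m.-1 * bool) := if l.2 then high l.1 else low l.1.
Definition under_in (l : 'I_m.-1 * bool) := over_out l.
Definition under_out (l : 'I_m.-1 * bool) := over_in l.

Definition letter (k : 'I_(size w)) := tnth (in_tuple w) k.

(* (k, j) is the segment in position j between the letters k-1 and k. *)
Definition segment : finType := ('I_(size w).+1 * 'I_m)%type.

Definition below (k : 'I_(size w)) (j : 'I_m) : segment :=
  (widen_ord (leqnSn _) k, j).
Definition above (k : 'I_(size w)) (j : 'I_m) : segment := (lift ord0 k, j).

Definition passes (k : 'I_(size w)) (j j' : 'I_m) : bool :=
  (j == over_in (letter k)) && (j' == over_out (letter k))
  || [&& j != low (letter k).1, j != high (letter k).1 & j' == j].

(* y follows x on the same arc, either through a letter that x does not
   underpass or through the closure of the braid. *)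
Definition joined (x y : segment) : bool :=
  [exists k, [&& x == below k x.2, y == above k y.2 & passes k x.2 y.2]]
  || [&& x.1 == ord_max, y.1 == ord0 & x.2 == y.2].

Definition same_arc : rel segment :=
  connect (fun x y => joined x y || joined y x).

Lemma joined_sym : connect_sym (fun x y => joined x y || joined y x).
Proof. by apply: sym_connect_sym => x y; rewrite orbC. Qed.

(* Arcs are classes for same_arc, given by a representative. *)
Definition braid_arc : finType :=
  {x : segment | x \in roots (fun x y => joined x y || joined y x)}.

Definition arc_of (x : segment) : braid_arc :=
  exist _ (fingraph.root (fun x y => joined x y || joined y x) x)
          (roots_root joined_sym x).

Lemma arc_of_eq x y : (arc_of x == arc_of y) = same_arc x y.
Proof. by rewrite -val_eqE /= (root_connect joined_sym). Qed.

Definition closed_braid : diagram :=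
  {| arc := braid_arc;
     crossing := 'I_(size w);
     omega k := arc_of (below k (over_in (letter k)));
     lambda k := if (letter k).2 then arc_of (above k (under_out (letter k)))
                 else arc_of (below k (under_in (letter k)));
     rho k := if (letter k).2 then arc_of (below k (under_in (letter k)))
              else arc_of (above k (under_out (letter k)));
     positive k := (letter k).2 |}.

End ClosedBraid.

(* The closure of (sigma_(m-1) sigma_(m-2) ... sigma_1)^n. *)
Definition torus_word (m n : nat) : seq ('I_m.-1 * bool) :=
  flatten (nseq n [seq (i, true) | i <- rev (enum 'I_m.-1)]).

Definition torus_link (m n : nat) : diagram := closed_braid (torus_word m n).

Section AlexanderModule.
Variables (F : fieldType) (D : diagram).
Local Notation L := (laurent F).
Local Notation t := (laurent_t F).

Definition free_gen (a : arc D) : {ffun arc D -> L^o} := [ffun b => (b == a)%:R].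

Definition crossing_relator (c : crossing D) : {ffun arc D -> L^o} :=
  free_gen (lambda c)
  - (t *: free_gen (rho c) + (1 - t) *: free_gen (omega c)).

Definition alexander_module := span_quot crossing_relator.
HB.instance Definition _ := GRing.Lmodule.on alexander_module.

Definition alexander_gen (a : arc D) : alexander_module :=
  span_pi crossing_relator (free_gen a).

Lemma alexander_relation c :
  alexander_gen (lambda c)
  = t *: alexander_gen (rho c) + (1 - t) *: alexander_gen (omega c).
Proof.
transitivity (span_pi crossing_relator
    (t *: free_gen (rho c) + (1 - t) *: free_gen (omega c)));
  last by rewrite linearD !linearZ.
apply/span_piP/asboolP; exists (fun k => (k == c)%:R).
rewrite (bigD1 c) //= eqxx scale1r big1 ?addr0 // => k /negPf kc.
by rewrite kc scale0r.
Qed.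

End AlexanderModule.

Definition nu' (F : fieldType) (h : {poly F}) (D : diagram) : nat :=
  primary_multiplicity (alexander_module F D) (laurent_of_poly h).

Section Representations.
Variables (F : fieldType) (E : fieldExtType F) (theta : E).
Variables (theta_neq0 : theta != 0) (D : diagram).
Local Notation L := (laurent F).
Local Notation A := (alexander_module F D).
Local Notation t := (laurent_t F).
Local Notation ev := (laurent_eval theta_neq0).

(* Hom_L(A, E), where x : L acts on E as multiplication by ev x. *)
Definition Rep := {linear A -> E | ev \; *%R}.

Definition rep_fun (f : Rep) : A -> E := GRing.Linear.sort f.
Local Coercion rep_fun : Rep >-> Funclass.

Lemma repP (f g : Rep) : f =1 g -> f = g.
Proof.
case: f g => [f [[f1] [f2]]] [g [[g1] [g2]]] fg.
have {}fg : f = g by apply: funext.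
rewrite fg in f1 f2 *.
by rewrite (Prop_irrelevance f1 g1) (Prop_irrelevance f2 g2).
Qed.

Definition rep_of (f : A -> E) (fL : linear_for (ev \; *%R) f) : Rep :=
  HB.pack f (GRing.isLinear.Build L A E (ev \; *%R) f fL).

Lemma rep_linear (f : Rep) : linear_for (ev \; *%R) f.
Proof. exact: (@linearP _ _ _ _ f). Qed.

Lemma rep_zero_subproof : linear_for (ev \; *%R) (fun _ : A => 0).
Proof. by move=> a x y /=; rewrite mulr0 addr0. Qed.

Lemma rep_opp_subproof (f : Rep) : linear_for (ev \; *%R) (fun x => - f x).
Proof. by move=> a x y /=; rewrite rep_linear /= opprD mulrN. Qed.

Lemma rep_add_subproof (f g : Rep) :
  linear_for (ev \; *%R) (fun x => f x + g x).
Proof. by move=> a x y /=; rewrite !rep_linear /= mulrDr addrACA. Qed.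

Lemma rep_scale_subproof (b : E) (f : Rep) :
  linear_for (ev \; *%R) (fun x => b * f x).
Proof. by move=> a x y /=; rewrite !rep_linear /= mulrDr mulrCA. Qed.

Definition rep_zero := rep_of rep_zero_subproof.
Definition rep_opp f := rep_of (rep_opp_subproof f).
Definition rep_add f g := rep_of (rep_add_subproof f g).
Definition rep_scale b f := rep_of (rep_scale_subproof b f).

HB.instance Definition _ := gen_eqMixin Rep.
HB.instance Definition _ := gen_choiceMixin Rep.

Lemma rep_addA : associative rep_add.
Proof. by move=> f g h; apply: repP => x; apply: addrA. Qed.
Lemma rep_addC : commutative rep_add.
Proof. by move=> f g; apply: repP => x; apply: addrC. Qed.
Lemma rep_add0 : left_id rep_zero rep_add.
Proof. by move=> f; apply: repP => x; apply: add0r. Qed.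
Lemma rep_addN : left_inverse rep_zero rep_opp rep_add.
Proof. by move=> f; apply: repP => x; apply: addNr. Qed.

HB.instance Definition _ :=
  GRing.isZmodule.Build Rep rep_addA rep_addC rep_add0 rep_addN.

Lemma rep_scaleA a b f : rep_scale a (rep_scale b f) = rep_scale (a * b) f.
Proof. by apply: repP => x; apply: mulrA. Qed.
Lemma rep_scale1 : left_id 1 rep_scale.
Proof. by move=> f; apply: repP => x; apply: mul1r. Qed.
Lemma rep_scaleDr : right_distributive rep_scale +%R.
Proof. by move=> a f g; apply: repP => x; apply: mulrDr. Qed.
Lemma rep_scaleDl f : {morph rep_scale^~ f : a b / a + b}.
Proof. by move=> a b; apply: repP => x; apply: mulrDl. Qed.

HB.instance Definition _ := GRing.Zmodule_isLmodule.Build E Rep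
  rep_scaleA rep_scale1 rep_scaleDr rep_scaleDl.

(* Finite dimension: a homomorphism is determined by its values on the arcs,
   which are arbitrary up to one linear condition per crossing. *)
Definition colour_defect (u : {ffun arc D -> E^o}) : {ffun crossing D -> E^o} :=
  [ffun c => u (lambda c) - (theta * u (rho c) + (1 - theta) * u (omega c))].

Lemma colour_defect_linear : linear colour_defect.
Proof.
by move=> a u v; apply/ffunP=> c; rewrite !ffunE /= /GRing.scale /=; ring.
Qed.

HB.instance Definition _ := GRing.isLinear.Build E
  {ffun arc D -> E^o} {ffun crossing D -> E^o} *:%R colour_defect
  colour_defect_linear.

Definition colourings : {vspace {ffun arc D -> E^o}} :=
  lker (linfun colour_defect).

Definition rep_colouring (f : Rep) : {ffun arc D -> E^o} :=
  [ffun a => f (alexander_gen F a)].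

Definition eval_colouring (u : {ffun arc D -> E^o})
    (x : {ffun arc D -> L^o}) : E := \sum_a ev (x a) * u a.

Lemma eval_colouring_linear u : linear_for (ev \; *%R) (eval_colouring u).
Proof.
move=> a x y; rewrite /eval_colouring /= mulr_sumr -big_split /=.
apply: eq_bigr => b _; rewrite !ffunE /GRing.scale /=.
by rewrite rmorphD rmorphM /= mulrDl mulrA.
Qed.

HB.instance Definition _ u := GRing.isLinear.Build L {ffun arc D -> L^o} E
  (ev \; *%R) (eval_colouring u) (eval_colouring_linear u).

Lemma eval_colouring_gen u a : eval_colouring u (free_gen F a) = u a.
Proof.
rewrite /eval_colouring (bigD1 a) //= ffunE eqxx rmorph1 mul1r big1 ?addr0 //.
by move=> b /negPf ba; rewrite ffunE ba rmorph0 mul0r.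
Qed.

Lemma eval_colouring_relator u c :
  eval_colouring u (crossing_relator F c) = colour_defect u c.
Proof.
rewrite /crossing_relator linearB linearD !linearZ /= !eval_colouring_gen.
by rewrite ffunE rmorphB rmorph1 /= laurent_eval_t.
Qed.

Lemma eval_colouring_repr u x : u \in colourings ->
  eval_colouring u (repr (span_pi (@crossing_relator F D) x))
  = eval_colouring u x.
Proof.
rewrite memv_ker lfunE => /eqP u0; apply/eqP; rewrite -subr_eq0 -linearB.
have /span_piP/asboolP[c ->] := span_piK (span_pi (@crossing_relator F D) x).
rewrite linear_sum big1 // => k _.
by rewrite linearZ /= eval_colouring_relator u0 ffunE mulr0.
Qed.

Lemma colouring_rep_subproof u : u \in colourings ->
  linear_for (ev \; *%R) (fun x : A => eval_colouring u (repr x)).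
Proof.
move=> uD a x y; rewrite -[in LHS](span_piK x) -[in LHS](span_piK y).
by rewrite -linearP eval_colouring_repr // linearP.
Qed.

Definition colouring_rep (u : subvs_of colourings) : Rep :=
  rep_of (colouring_rep_subproof (subvsP u)).

Lemma rep_colouring_linear : linear rep_colouring.
Proof. by move=> a f g; apply/ffunP=> b; rewrite !ffunE. Qed.

Lemma rep_colouringP f : rep_colouring f \in colourings.
Proof.
rewrite memv_ker lfunE; apply/eqP/ffunP=> c; rewrite !ffunE.
rewrite alexander_relation rep_linear /= laurent_eval_t.
have -> : f ((1 - t) *: alexander_gen F (omega c))
    = (1 - theta) * f (alexander_gen F (omega c)).
  rewrite -[_ *: _]addr0 rep_linear /= rmorphB rmorph1 /= laurent_eval_t.
  by rewrite /rep_fun linear0 addr0.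
by rewrite subrr.
Qed.

Lemma colouring_repK u : rep_colouring (colouring_rep u) = vsval u.
Proof.
by apply/ffunP=> a; rewrite ffunE /= eval_colouring_repr ?subvsP //
  eval_colouring_gen.
Qed.

Lemma rep_colouring_inj : injective rep_colouring.
Proof.
move=> f g fg; apply: repP => x; rewrite -(span_piK x).
set y := repr x.
have -> : y = \sum_a y a *: free_gen F a.
  apply/ffunP=> b; rewrite sum_ffunE (bigD1 b) //= big1 ?addr0.
    by rewrite !ffunE eqxx /GRing.scale /= mulr1.
  by move=> a /negPf ab; rewrite !ffunE eq_sym ab /GRing.scale /= mulr0.
rewrite /rep_fun !linear_sum; apply: eq_bigr => a _.
rewrite !linearZ /=; congr (_ * _).
by have /ffunP/(_ a) := fg; rewrite !ffunE.
Qed.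

Import VectorInternalTheory.

Definition rep_coord (f : Rep) :=
  v2r (vsproj colourings (rep_colouring f)).

Lemma rep_coord_linear : linear rep_coord.
Proof.
move=> a f g; rewrite /rep_coord rep_colouring_linear.
set u := rep_colouring f; set v := rep_colouring g.
have -> : vsproj colourings (a *: u + v)
    = a *: vsproj colourings u + vsproj colourings v by exact: linearP.
exact: linearP.
Qed.

Lemma rep_coord_bij : bijective rep_coord.
Proof.
exists (fun r => colouring_rep (r2v r)) => [f|r].
  rewrite /rep_coord v2rK; apply: rep_colouring_inj.
  by rewrite colouring_repK vsprojK // rep_colouringP.
by rewrite /rep_coord colouring_repK vsvalK r2vK.
Qed.

HB.instance Definition _ := Lmodule_hasFinDim.Build E Rep
  (exist2 _ _ rep_coord rep_coord_linear rep_coord_bij).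

End Representations.

Coercion rep_fun : Rep >-> Funclass.

Definition form_rank (E : fieldType) (V : vectType E) (b : V -> V -> E) : nat :=
  \rank (\matrix_(i < \dim {:V}, j < \dim {:V})
           b (vbasis {:V})`_i (vbasis {:V})`_j).

(* Conjugation over the finite field F: when E is quadratic over F, its
   non-trivial F-automorphism is the Frobenius map. *)
Definition conj (F : finFieldType) (E : fieldExtType F) (x : E) : E :=
  x ^+ #|{: F}|.

Lemma norm1_neq0 (F : finFieldType) (E : fieldExtType F) (theta : E) :
  theta * conj theta = 1 -> theta != 0.
Proof.
by move=> theta1; apply: contra_eq_neq theta1 => ->; rewrite mul0r eq_sym oner_eq0.
Qed.

Definition eta (F : finFieldType) (E : fieldExtType F) (theta : E)
    (theta_neq0 : theta != 0) (ii : E) (D : diagram)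
    (f g : Rep theta_neq0 D) : E :=
  \sum_(c : crossing D)
     (if positive c then 1 else -1) * ii *
     (f (alexander_gen F (rho c)) * conj (g (alexander_gen F (omega c)))
      - f (alexander_gen F (omega c)) * conj (g (alexander_gen F (rho c)))).

(* ord_a(b), the least k > 0 with b ^ k = 1 modulo a, for coprime a > 0 and b.
   The group of units of 'Z_a is not used because 'Z_1 is Z/2. *)
Definition mult_order (a b : nat) : nat :=
  head 0%N [seq k <- iota 1 a | b ^ k == 1 %[mod a]].

Lemma mult_orderP a b : (0 < a)%N -> coprime a b ->
  [/\ (0 < mult_order a b)%N, b ^ mult_order a b = 1 %[mod a]
    & forall k, (0 < k)%N -> b ^ k = 1 %[mod a] -> (mult_order a b <= k)%N].
Proof.
move=> a_gt0 ab; rewrite /mult_order; set s := filter _ _.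
have in_s k : (k \in s) = [&& b ^ k == 1 %[mod a], (0 < k)%N & (k <= a)%N].
  by rewrite mem_filter mem_iota add1n ltnS.
have tot_s : totient a \in s.
  rewrite in_s totient_gt0 a_gt0 cyclic.Euler_exp_totient 1?coprime_sym // eqxx /=.
  rewrite totient_count_coprime big_mkord.
  apply: (@leq_trans (\sum_(i < a) 1)%N); last by rewrite sum_nat_const card_ord muln1.
  by apply: leq_sum => i _; apply: leq_b1.
have : sorted ltn s by apply: sorted_filter (iota_ltn_sorted _ _); apply: ltn_trans.
case: s in_s tot_s => // x s in_s _ /= /(order_path_min ltn_trans)/allP x_min.
have := in_s x; rewrite mem_head => /esym/and3P[/eqP xE x_gt0 xa].
split=> // k k_gt0 /eqP kE; case: (leqP k a) => [ka|]; last first.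
  by move=> /ltnW; apply: leq_trans.
have : k \in x :: s by rewrite in_s kE k_gt0.
by rewrite inE => /predU1P[->//|/x_min /ltnW].
Qed.

(* Main.v *)
(* Let A be the Alexander module and A[h] its h-torsion.  Decomposing A into
   primary cyclic modules, evaluation on A[h] kills Hom(M, E) for every summand
   M that is not isomorphic to Lambda / (h), and has rank 1 for M = Lambda / (h);
   hence nu'_h is the codimension in Rep of the f that vanish on A[h], and it
   suffices to show that these f form the radical of eta.

   Put d(f)_c = f(rho c) - f(omega c).  Differentiating at theta a relation
   h x = sum_c C_c r_c in the free module on the arcs gives
   h'(theta) f(x) = - sum_c C_c(theta) d(f)_c, so f vanishes on A[h] if and only
   if d(f) is orthogonal to the left kernel of the relation matrix at theta.

   In a positive closed braid, g in Rep yields by conjugation a family Y of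
   colours which is transported along the strings by the rule for theta^-1.  A
   triangular change of coordinates turns Y into a covector transported by the
   transpose of the rule for theta, and so into a vector beta(g) of the left
   kernel.  Telescoping sum_j x_j y_j and sum_j j x_j mu_j along the braid shows
   that eta(f, g) is a non-zero multiple of sum_c beta(g)_c d(f)_c.  Conversely,
   if d(f) is orthogonal to all the beta(g), the Fredholm alternative solves the
   relations with defects d(f), so d(f) is orthogonal to the left kernel. *)
From HB Require Import structures.
Require Import Defs.
From mathcomp Require Import all_boot all_order all_algebra all_field.
From mathcomp Require Import boolp classical_sets.
From mathcomp Require pgroup abelian.
From mathcomp Require Import ring.

Set Implicit Arguments.
Unset Strict Implicit.
Unset Printing Implicit Defensive.

Import GRing.Theory.
Local Open Scope ring_scope.

(** * Divisibility, Bezout relations and valuations in a Euclidean domain *)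

Section EuclideanDomain.
Variables (R : comNzRingType) (v : R -> nat).

Definition divides (a b : R) := exists c, b = c * a.

(** The norm of 0 is left arbitrary: a remainder is demanded only when division is not exact, so it
    is never 0. Additivity of the norm bounds the length of factorizations. *)
Record euclidean_norm : Prop := EuclideanNorm {
  eucl_integral : forall a b : R, a * b = 0 -> a = 0 \/ b = 0;
  eucl_normM : forall a b : R, a <> 0 -> b <> 0 -> v (a * b) = (v a + v b)%N;
  eucl_inv : forall a : R, a <> 0 -> v a = 0%N -> invertible a;
  eucl_div : forall a b : R, b <> 0 -> ~ divides b a ->
    exists q, a - q * b <> 0 /\ (v (a - q * b) < v b)%N }.

Hypothesis Rv : euclidean_norm.

Lemma eucl_mulIf (a b c : R) : c <> 0 -> a * c = b * c -> a = b.
Proof.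
move=> c0 /eqP; rewrite -subr_eq0 -mulrBl => /eqP/(eucl_integral Rv)[|//].
by move/eqP; rewrite subr_eq0 => /eqP.
Qed.

Lemma eucl_norm_gt0 (a : R) : a <> 0 -> ~ invertible a -> (0 < v a)%N.
Proof. by move=> a0 aN; rewrite lt0n; apply/eqP => /(eucl_inv Rv a0). Qed.

(** A factorization into two non-units splits the norm into two positive parts, so descent on the
    norm ends at an irreducible factor. *)
Lemma irreducible_factor (a : R) : a <> 0 -> ~ invertible a ->
  exists pi, irreducible pi /\ divides pi a.
Proof.
have [n] := ubnP (v a); elim: n a => // n IHn a va a0 aN.
case: (EM (irreducible a)) => [a_irr|a_red].
  by exists a; split=> //; exists 1; rewrite mul1r.
have [[b c] abc] : exists bc, [/\ a = bc.1 * bc.2, ~ invertible bc.1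
    & ~ invertible bc.2].
  apply: contrapT => noP; apply: a_red; split=> // b c abc.
  case: (EM (invertible b)) => [|bN]; first by left.
  case: (EM (invertible c)) => [|cN]; first by right.
  by case: noP; exists (b, c).
case: abc => /= abc bN cN.
have b0 : b <> 0 by move=> b0; apply: a0; rewrite abc b0 mul0r.
have c0 : c <> 0 by move=> c0; apply: a0; rewrite abc c0 mulr0.
have [|pi [pi_irr [d bE]]] := IHn b _ b0 bN.
  move: va; rewrite abc (eucl_normM Rv) // ltnS.
  have := eucl_norm_gt0 c0 cN; case: (v c) => // k _.
  by apply: leq_trans; rewrite addnS ltnS leq_addr.
by exists pi; split=> //; exists (d * c); rewrite abc bE mulrAC.
Qed.

(** Euclid's algorithm on the non-zero combinations of [a] and [b]: one that fails to divide [a] or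
    [b] leaves a remainder that is again a combination, of smaller norm. *)
Lemma bezout (a b : R) : a <> 0 ->
  exists d u w, [/\ d = u * a + w * b, divides d a & divides d b].
Proof.
move=> a0.
suff: forall n c, (v c < n)%N -> c <> 0 -> (exists u w, c = u * a + w * b) ->
    exists d u w, [/\ d = u * a + w * b, divides d a & divides d b].
  move=> /(_ (v a).+1 a (leqnn _) a0); apply.
  by exists 1, 0; rewrite mul1r mul0r addr0.
elim=> // n IHn c vc c0 [u [w cE]].
case: (EM (divides c a)) => [ca|/(eucl_div Rv c0)[q [r0 vr]]]; last first.
  apply: (IHn (a - q * c)) => //; first exact: leq_trans vr _.
  by exists (1 - q * u), (- (q * w)); rewrite {1}cE; ring.
case: (EM (divides c b)) => [cb|/(eucl_div Rv c0)[q [r0 vr]]]; last first.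
  apply: (IHn (b - q * c)) => //; first exact: leq_trans vr _.
  by exists (- (q * u)), (1 - q * w); rewrite {1}cE; ring.
by exists c, u, w.
Qed.

Lemma irreducible_coprime (pi a : R) : irreducible pi -> ~ divides pi a ->
  exists u w, u * pi + w * a = 1.
Proof.
move=> [pi0 piN pi_irr] piNa.
have [d [u [w [dE [c piE] [k aE]]]]] := bezout a pi0.
case: (pi_irr _ _ piE) => [[c' cc']|[d' dd']].
  case: piNa; exists (k * c').
  by rewrite piE aE -mulrA [c' * _]mulrA [c' * c]mulrC cc' mul1r.
by exists (d' * u), (d' * w); rewrite -!mulrA -mulrDr -dE mulrC.
Qed.

Lemma coprime_exp (pi a : R) e : (exists u w, u * pi + w * a = 1) ->
  exists u w, u * pi ^+ e + w * a = 1.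
Proof.
move=> [u [w uw]]; elim: e => [|e [u' [w' uw']]].
  by exists 1, 0; rewrite mul0r addr0 mulr1.
exists (u * u'), (u * pi * w' + w); rewrite -[RHS]uw exprS.
rewrite -[in RHS](mulr1 (u * pi)) -uw'; ring.
Qed.

Lemma irreducible_valuation (pi a : R) : irreducible pi -> a <> 0 ->
  exists e b, a = pi ^+ e * b /\ ~ divides pi b.
Proof.
move=> pi_irr; have [pi0 piN _] := pi_irr; have [n] := ubnP (v a).
elim: n a => // n IHn a va a0.
case: (EM (divides pi a)) => [[b aE]|]; last by exists 0%N, a; rewrite mul1r.
have b0 : b <> 0 by move=> b0; apply: a0; rewrite aE b0 mul0r.
have [|e [c [bE piNc]]] := IHn b _ b0.
  move: va; rewrite aE (eucl_normM Rv) // ltnS.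
  by apply: leq_trans; rewrite -addn1 leq_add2l eucl_norm_gt0.
by exists e.+1, c; rewrite aE bE exprS mulrC mulrA.
Qed.

End EuclideanDomain.

Definition linear_of (R : pzRingType) (U V : lmodType R) (f : U -> V)
    (fL : linear f) : {linear U -> V} :=
  HB.pack f (GRing.isLinear.Build R U V *:%R f fL).

(** * Cyclic modules and the homomorphisms out of them *)

Section CyclicModule.
Variables (R : comNzRingType) (a : R).

Local Notation cpi := (span_pi (fun _ : unit => a : R^o)).

Lemma in_span_cyclic (x : R^o) :
  in_span (fun _ : unit => a : R^o) x <-> divides a x.
Proof.
split=> [/asboolP[c ->]|[c ->]].
  by exists (c tt); rewrite (bigD1 tt) //= big1 ?addr0 // => -[].
apply/asboolP; exists (fun=> c).
by rewrite (bigD1 tt) //= big1 ?addr0 // => -[].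
Qed.

Lemma cyclic_pi_eq0 (x : R^o) : cpi x = 0 <-> divides a x.
Proof.
rewrite -in_span_cyclic -[x in in_span _ x]subr0; split=> [x0|/span_piP->].
  by apply/span_piP; rewrite x0 linear0.
by rewrite linear0.
Qed.

Variables (M : lmodType R) (g : M).

(** The candidate for the homomorphism sending the class of 1 to [g]; the representative becomes
    immaterial once [a *: g = 0]. *)
Definition cyclic_map (z : cyclic_module a) : M := (repr z : R) *: g.

Hypothesis ag0 : a *: g = 0.

Lemma cyclic_map_pi (x : R^o) : cyclic_map (cpi x) = (x : R) *: g.
Proof.
apply/eqP; rewrite -subr_eq0 /cyclic_map -scalerBl.
have /span_piP/in_span_cyclic[c ->] := span_piK (cpi x).
by rewrite -scalerA ag0 scaler0.
Qed.

Lemma cyclic_map_linear : linear cyclic_map.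
Proof.
move=> c x y; rewrite -(span_piK x) -(span_piK y) -linearP !cyclic_map_pi.
by rewrite scalerDl scalerA.
Qed.

End CyclicModule.

Lemma cyclic_module_associated (R : comNzRingType) (a b : R) :
  divides a b -> divides b a ->
  lmod_isomorphic (cyclic_module a) (cyclic_module b).
Proof.
move=> ab ba.
pose one (d : R) := span_pi (fun _ : unit => d : R^o) (1 : R^o).
have piZ (d : R) (x : R^o) : (x : R) *: one d = span_pi _ x.
  by rewrite -linearZ; congr span_pi; rewrite /GRing.scale /= mulr1.
have kill (c d : R) : divides d c -> c *: one d = 0.
  by move=> dc; rewrite piZ; apply/cyclic_pi_eq0.
exists (linear_of (cyclic_map_linear (kill _ _ ba))).
exists (@cyclic_map R b _ (one a)) => x /=.
  rewrite -(span_piK x) (cyclic_map_pi (kill _ _ ba)) piZ.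
  by rewrite (cyclic_map_pi (kill _ _ ab)) piZ.
rewrite -(span_piK x) (cyclic_map_pi (kill _ _ ab)) piZ.
by rewrite (cyclic_map_pi (kill _ _ ba)) piZ.
Qed.

(** * Primary decomposition of finitely generated modules over a Euclidean domain *)

Section PrimaryDecompositionExistence.
Variables (R : comNzRingType) (M : lmodType R).
Implicit Types (S : M -> Prop) (g : M).

(** Submodules of [M] are handled as predicates, each given as the image of an embedded primary sum,
    so that the inductions stay inside one fixed module. *)
Definition decomposable S : Prop := exists r s,
  (forall pi e, (pi, e) \in s -> irreducible pi /\ (0 < e)%N) /\
  exists psi : {linear primary_sum r s -> M},
    injective psi /\ forall x, S x <-> exists y, x = psi y.

Lemma decomposable_ext S S' :
  (forall x, S x <-> S' x) -> decomposable S -> decomposable S'.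
Proof.
move=> SS' [r [s [ss [psi [psi_inj psiP]]]]]; exists r, s; split=> //.
by exists psi; split=> // x; rewrite -SS' psiP.
Qed.

Definition spanned n (g : 'I_n -> M) (x : M) : Prop :=
  exists c : 'I_n -> R, x = \sum_i c i *: g i.

Lemma decomposable_free n (g : 'I_n -> M) :
  (forall c : 'I_n -> R, \sum_i c i *: g i = 0 -> forall i, c i = 0) ->
  decomposable (spanned g).
Proof.
move=> g_free; exists n, [::]; split=> //=.
pose psi (x : 'rV[R]_n) := \sum_i x 0 i *: g i.
have psiL : linear psi.
  move=> a x y; rewrite /psi scaler_sumr -big_split; apply: eq_bigr => i _.
  by rewrite !mxE scalerDl scalerA.
exists (linear_of psiL).
split=> [x y xy|x] /=.
  apply/rowP=> i; apply/eqP; rewrite -subr_eq0; apply/eqP.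
  apply: (g_free (fun i => x 0 i - y 0 i)); apply/eqP.
  under eq_bigr do rewrite scalerBl.
  by rewrite sumrB subr_eq0; apply/eqP.
split=> [[c ->]|[y ->]]; last by exists (y 0).
by exists (\row_i c i); apply: eq_bigr => i _; rewrite mxE.
Qed.

Definition direct_line S g : Prop := forall c, S (c *: g) -> c *: g = 0.

Lemma decomposable_primary S pi e g : irreducible pi -> (0 < e)%N ->
  (forall c, c *: g = 0 <-> divides (pi ^+ e) c) ->
  decomposable S -> direct_line S g ->
  decomposable (fun x => exists c y, S y /\ x = c *: g + y).
Proof.
move=> pi_irr e_gt0 g_ann [r [s [ss [psi [psi_inj psiP]]]]] Sg.
have g0 : pi ^+ e *: g = 0 by apply/g_ann; exists 1; rewrite mul1r.
exists r, ((pi, e) :: s); split.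
  by move=> pi' e'; rewrite inE => /predU1P[[-> ->]|/ss].
pose phi (z : (cyclic_module (pi ^+ e) * primary_sum r s)%type) :=
  cyclic_map g z.1 + psi z.2.
have phiL : linear phi.
  move=> a x y; rewrite /phi /= cyclic_map_linear // linearP scalerDr.
  by rewrite addrACA.
exists (linear_of phiL).
split=> [|x] /=.
  suff phi0 z : phi z = 0 -> z = 0.
    move=> x y xy; apply/eqP; rewrite -subr_eq0; apply/eqP/phi0.
    rewrite -[- y]scaleN1r addrC phiL.
    by have -> : phi x = phi y by []; rewrite scaleN1r addNr.
  case: z => z1 z2; rewrite /phi /= -[z1]span_piK; set x := repr z1.
  rewrite cyclic_map_pi // => xz0.
  have xg0 : x *: g = 0.
    apply: Sg; apply/psiP; exists (- z2); rewrite linearN.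
    by apply/eqP; rewrite -addr_eq0; apply/eqP.
  move: (xz0); rewrite xg0 add0r => z20.
  congr (_, _); first by apply/cyclic_pi_eq0/g_ann.
  by apply: psi_inj; rewrite linear0.
split=> [[c [y [/psiP[z ->] ->]]]|[[z1 z2] ->]].
  by exists (span_pi _ (c : R^o), z); rewrite /phi /= cyclic_map_pi.
exists (repr z1 : R), (psi z2); split=> //.
by apply/psiP; exists z2.
Qed.

Variables (v : R -> nat) (Rv : euclidean_norm v).

(** Chinese remainders: if [d = pi ^+ e * b] with [b] prime to [pi], the line of [g] is the direct
    sum of the lines of [b *: g] and [pi ^+ e *: g], with annihilators [pi ^+ e] and [b]. The second
    is handled by induction on the norm of [d]. *)
Lemma decomposable_cyclic S d g :
  d <> 0 ->
  (forall c, c *: g = 0 <-> divides d c) ->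
  decomposable S -> direct_line S g ->
  decomposable (fun x => exists c y, S y /\ x = c *: g + y).
Proof.
have [n] := ubnP (v d); elim: n d g => // n IHn d g vd d0 g_ann S_dec Sg.
case: (EM (invertible d)) => [[d' dd']|dN].
  have g0 : g = 0 by rewrite -[g]scale1r g_ann; exists d'; rewrite mulrC.
  apply: decomposable_ext S_dec => x; split=> [Sx|[c [y [Sy ->]]]].
    by exists 0, x; rewrite scale0r add0r.
  by rewrite g0 scaler0 add0r.
have [pi [pi_irr pid]] := irreducible_factor Rv d0 dN.
have [pi0 piN _] := pi_irr.
have [e [b [dE pib]]] := irreducible_valuation Rv pi_irr d0.
have e_gt0 : (0 < e)%N.
  by case: e dE => // dE; case: pib; rewrite -[b]mul1r -[1 * b]dE.
have b0 : b <> 0 by move=> b0; apply: d0; rewrite dE b0 mulr0.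
have pie0 : pi ^+ e <> 0.
  by move=> pie0; apply: d0; rewrite dE pie0 mul0r.
have [u [w uw]] := coprime_exp e (irreducible_coprime Rv pi_irr pib).
have annb c : c *: (b *: g) = 0 <-> divides (pi ^+ e) c.
  rewrite scalerA g_ann dE; split=> [[k kE]|[k ->]]; exists k; last by ring.
  by apply: (eucl_mulIf Rv b0); rewrite kE mulrA.
have annpi c : c *: (pi ^+ e *: g) = 0 <-> divides b c.
  rewrite scalerA g_ann dE; split=> [[k kE]|[k ->]]; exists k; last by ring.
  by apply: (eucl_mulIf Rv pie0); rewrite kE; ring.
have vb : (v b < n)%N.
  move: vd; rewrite dE (eucl_normM Rv) // ltnS; apply: leq_trans.
  rewrite -addn1 addnC leq_add2r (eucl_norm_gt0 Rv) // => -[k kE].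
  apply: piN; case: e e_gt0 kE {dE uw pie0 annb annpi} => // e _ kE.
  by exists (pi ^+ e * k); rewrite mulrA -exprS.
have dir_pi : direct_line S (pi ^+ e *: g).
  by move=> c; rewrite scalerA => /Sg.
have S'dec := IHn b _ vb b0 annpi S_dec dir_pi.
apply: decomposable_ext (decomposable_primary pi_irr e_gt0 annb S'dec _) => [x|c].
  split=> [[c [y [[c' [z [Sz ->]]] ->]]]|[c [y [Sy ->]]]].
    exists (c * b + c' * pi ^+ e), z; split=> //.
    by rewrite scalerDl !scalerA addrA.
  exists (c * w), (c * u *: (pi ^+ e *: g) + y); split; first by exists (c * u), y.
  rewrite !scalerA addrA -scalerDl; congr (_ *: g + y).
  by rewrite -[LHS]mulr1 -uw; ring.
(* Directness of the new line: [c * b - c' * pi ^+ e] sends [g] into [S], hence is a multiple of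
   [d]; the Bezout relation then makes [c] divisible by [pi ^+ e]. *)
move=> [c' [y [Sy cE]]].
have Sd : S ((c * b - c' * pi ^+ e) *: g).
  by rewrite scalerBl -!scalerA cE addrC addKr.
have /Sg/g_ann[k kE] := Sd.
apply/annb; exists (c * u + w * (c' + k * b)).
transitivity (c * u * pi ^+ e + w * (c * b)).
  by rewrite -{1}[c]mulr1 -uw; ring.
have -> : c * b = c' * pi ^+ e + k * d by rewrite -kE addrC subrK.
by rewrite dE; ring.
Qed.

(** When [q i = 0] this is an elementary change of generators, whose inverse is the shear by
    [- q]. *)
Definition shear n (i : 'I_n) (q : 'I_n -> R) (g : 'I_n -> M) (j : 'I_n) : M :=
  g j + (j == i)%:R *: \sum_k q k *: g k.

Lemma shear_sum n (i : 'I_n) q (g : 'I_n -> M) (c : 'I_n -> R) :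
  \sum_j c j *: shear i q g j = \sum_j (c j + c i * q j) *: g j.
Proof.
rewrite /shear; under eq_bigr do rewrite scalerDr scalerA.
rewrite big_split /= [X in _ + X](bigD1 i) //= eqxx mulr1 [X in _ + (_ + X)]big1.
  rewrite addr0 scaler_sumr -big_split; apply: eq_bigr => j _.
  by rewrite scalerDl scalerA.
by move=> j /negPf->; rewrite mulr0 scale0r.
Qed.

Lemma spanned_shear n (i : 'I_n) q (g : 'I_n -> M) x : q i = 0 ->
  spanned (shear i q g) x <-> spanned g x.
Proof.
move=> qi0; split=> -[c ->].
  by exists (fun j => c j + c i * q j); rewrite shear_sum.
exists (fun j => c j - c i * q j); rewrite shear_sum; apply: eq_bigr => j _.
by rewrite qi0 mulr0 subr0 subrK.
Qed.

(* A non-trivial relation among the generators whose i-th coefficient has minimal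
   norm, over all families obtained by a change of generators, has this
   coefficient divide the other ones and the i-th coefficient of every other
   relation; after a last change of generators the i-th one splits off. *)
Lemma decomposable_spanned n (g : 'I_n -> M) : decomposable (spanned g).
Proof.
elim: n g => [|n IHn] g; first by apply: decomposable_free => c _ [].
case: (EM (exists c i, \sum_j c j *: g j = 0 /\ c i <> 0)); last first.
  move=> free_g; apply: decomposable_free => c c0 i; apply: contrapT => ci.
  by apply: free_g; exists c, i.
case=> c [i []]; have [k] := ubnP (v (c i)).
elim: k => // k IHk in g c i *; rewrite ltnS => vk c0 ci0.
case: (EM (forall j, divides (c i) (c j))) => [/choice[f fE]|]; last first.
  move=> /existsNP[j cNj]; have [q [r0 vr]] := eucl_div Rv ci0 cNj.
  have ji : (j == i) = false.
    by apply/eqP => ji; apply: cNj; rewrite ji; exists 1; rewrite mul1r.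
  (* Adding [q *: g j] to the [i]-th generator turns the [j]-th coefficient of the relation into the
     remainder of [c j] by [c i]. *)
  pose q' k := if k == j then q else 0.
  have q'i : q' i = 0 by rewrite /q' eq_sym ji.
  apply: decomposable_ext (fun x => spanned_shear g x q'i) _.
  apply: (IHk _ (fun k => c k - c i * q' k) j); last by rewrite /q' eqxx mulrC.
    by apply: leq_trans vk; rewrite /q' eqxx mulrC.
  rewrite shear_sum -[RHS]c0; apply: eq_bigr => l _.
  by rewrite q'i mulr0 subr0 subrK.
pose q j := if j == i then 0 else f j.
have qi : q i = 0 by rewrite /q eqxx.
apply: decomposable_ext (fun x => spanned_shear g x qi) _.
set g' := shear i q g.
(* After the shear by the quotients [f j], the relation shrinks to [c i *: g' i = 0]. *)
pose c' j := if j == i then c i else 0.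
have c'0 : \sum_j c' j *: g' j = 0.
  rewrite shear_sum -[RHS]c0; apply: eq_bigr => l _; congr (_ *: _).
  rewrite /c' /q eqxx; case: eqVneq => [->|_]; first by rewrite mulr0 addr0.
  by rewrite add0r mulrC -fE.
case: (EM (forall z : 'I_n.+1 -> R,
    \sum_j z j *: g' j = 0 -> divides (c i) (z i))); last first.
  move=> /existsNP[z /not_implyP[z0 czi]].
  have [r [r0 vr]] := eucl_div Rv ci0 czi.
  apply: (IHk g' (fun j => z j - r * c' j) i); rewrite /c' ?eqxx //.
    exact: leq_trans vk.
  under eq_bigr do rewrite scalerBl -scalerA.
  by rewrite sumrB -scaler_sumr z0 c'0 scaler0 subr0.
move=> div_c.
have sum_lift (z : 'I_n.+1 -> R) :
    \sum_j z j *: g' j = z i *: g' i + \sum_j z (lift i j) *: g' (lift i j).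
  exact: (bigD1_ord i).
have ann_c x : x *: g' i = 0 <-> divides (c i) x.
  split=> [x0|[y ->]].
    have := div_c (fun j => if j == i then x else 0); rewrite eqxx; apply.
    rewrite sum_lift eqxx x0 add0r big1 // => j _.
    by rewrite eq_sym (negPf (neq_lift _ _)) scale0r.
  move: c'0; rewrite sum_lift {1}/c' eqxx big1 => [|j _].
    by rewrite addr0 -scalerA => ->; rewrite scaler0.
  by rewrite /c' eq_sym (negPf (neq_lift _ _)) scale0r.
have direct_c : direct_line (spanned (fun j => g' (lift i j))) (g' i).
  move=> x [y xE]; apply/ann_c.
  pose z j := if unlift i j is Some j' then - y j' else x.
  have zi : z i = x by rewrite /z unlift_none.
  rewrite -zi; apply: div_c; rewrite sum_lift zi xE -big_split big1 //= => j _.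
  by rewrite /z liftK scaleNr subrr.
apply: decomposable_ext (decomposable_cyclic ci0 ann_c (IHn _) direct_c) => x.
split=> [[a [y [[z ->] ->]]]|[z ->]].
  exists (fun j => if unlift i j is Some j' then z j' else a).
  rewrite sum_lift unlift_none; congr (_ + _).
  by apply: eq_bigr => j _; rewrite liftK.
exists (z i), (\sum_j z (lift i j) *: g' (lift i j)); split=> //.
by exists (fun j => z (lift i j)).
Qed.

Theorem primary_decomposition_exists n (g : 'I_n -> M) :
  (forall x, spanned g x) -> exists r s, primary_decomposition M r s.
Proof.
move=> g_gen; have [r [s [ss [psi [psi_inj psiP]]]]] := decomposable_spanned g.
have surj x : exists y, psi y = x.
  by have /psiP[y ->] := g_gen x; exists y.
have [f fK] := choice surj.
exists r, s; split=> //.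
have fL : linear f.
  by move=> a x y; apply: psi_inj; rewrite linearP !fK.
exists (linear_of fL); exists psi => [x|y]; first exact: fK.
exact/psi_inj/fK.
Qed.

End PrimaryDecompositionExistence.

(** * Laurent polynomials over a field form a Euclidean domain *)

Section LaurentRing.
Variable F : fieldType.
Local Notation L := (laurent F).
Local Notation t := (laurent_t F).
Local Notation lop := (@laurent_of_poly F).

Lemma laurent_of_poly_zmod : zmod_morphism lop.
Proof. by move=> P Q; apply: val_inj; rewrite /= tofracB. Qed.

Lemma laurent_of_poly_monoid : monoid_morphism lop.
Proof.
by split=> [|P Q]; apply: val_inj; rewrite /= ?tofrac1 ?tofracM.
Qed.

HB.instance Definition _ :=
  GRing.isZmodMorphism.Build {poly F} L lop laurent_of_poly_zmod.
HB.instance Definition _ :=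
  GRing.isMonoidMorphism.Build {poly F} L lop laurent_of_poly_monoid.

Lemma laurent_of_poly_inj : injective lop.
Proof. by move=> P Q /(congr1 val)/eqP; rewrite /= tofrac_eq => /eqP. Qed.

Lemma laurent_mulX (x : L) P n :
  laurent_val x * FracField.tofrac 'X ^+ n = FracField.tofrac P <->
  x * t ^+ n = lop P.
Proof.
have val_tn : laurent_val (t ^+ n) = FracField.tofrac 'X ^+ n.
  by rewrite -rmorphXn /= tofracXn.
split=> [xE|/(congr1 (@laurent_val F)) /=]; last by rewrite val_tn.
by apply: val_inj; rewrite /= -xE -val_tn.
Qed.

Lemma laurent_polyP (x : L) : exists P n, x * t ^+ n = lop P.
Proof. by have [[P n] /= /laurent_mulX xP] := laurent_fracP x; exists P, n. Qed.

Lemma laurent_tV : exists s : L, s * t = 1.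
Proof.
have sP : is_laurent (FracField.tofrac 'X : {fraction {poly F}})^-1.
  apply/is_laurentP; exists 1, 1%N; rewrite expr1 tofrac1 mulVf //.
  exact: (tofracX_neq0 F 1).
exists (Laurent sP); apply: val_inj; rewrite /= mulVf //.
exact: (tofracX_neq0 F 1).
Qed.

Lemma laurent_integral (x y : L) : x * y = 0 -> x = 0 \/ y = 0.
Proof.
move=> /(congr1 val)/eqP; rewrite /= mulf_eq0 => /orP[]/eqP.
  by left; apply: val_inj.
by right; apply: val_inj.
Qed.

Lemma laurent_poly_neq0 (x : L) P n : x <> 0 -> x * t ^+ n = lop P -> P != 0.
Proof.
move=> x0 xP; apply/eqP => P0; move: xP; rewrite P0 rmorph0.
move/laurent_integral=> [//|/eqP].
rewrite -rmorphXn /= -[X in _ == X](rmorph0 lop) => /eqP/laurent_of_poly_inj.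
by move/eqP; rewrite -size_poly_eq0 size_polyXn.
Qed.

(* The spread of the exponents occurring in P, which is not changed by
   multiplication by powers of X. *)
Definition poly_spread (P : {poly F}) : nat := ((size P).-1 - mup 0 P)%N.

Lemma poly_spreadK P : P != 0 -> (poly_spread P + mup 0 P)%N = (size P).-1.
Proof.
move=> P0; apply: subnK; rewrite -ltnS prednK ?size_poly_gt0 //.
have := mup_geq 0 (mup 0 P) P0; rewrite leqnn => /esym/(dvdp_leq P0).
by rewrite subr0 size_polyXn.
Qed.

Lemma poly_spreadM P Q : P != 0 -> Q != 0 ->
  poly_spread (P * Q) = (poly_spread P + poly_spread Q)%N.
Proof.
move=> P0 Q0; apply/eqP; rewrite -(eqn_add2r (mup 0 (P * Q))).
rewrite poly_spreadK ?mulf_neq0 // mupM // addnACA !poly_spreadK //.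
rewrite size_mul //; have := P0; have := Q0; rewrite -!size_poly_gt0.
by case: (size P) => // a; case: (size Q) => // b _ _; rewrite addSn addnS.
Qed.

Lemma poly_spreadXn n : poly_spread 'X^n = 0%N.
Proof.
rewrite /poly_spread size_polyXn /=.
by have := mup_XsubCX n (0 : F) 0; rewrite subr0 eqxx => ->; rewrite subnn.
Qed.

Definition laurent_spread (x : L) : nat :=
  poly_spread (sval (laurent_fracP x)).1.

Lemma laurent_spreadE x P n : x <> 0 -> x * t ^+ n = lop P ->
  laurent_spread x = poly_spread P.
Proof.
rewrite /laurent_spread; case: (laurent_fracP x) => -[Q k] /= /laurent_mulX xQ.
move=> x0 xP.
have QP : Q * 'X^n = P * 'X^k.
  by apply: laurent_of_poly_inj; rewrite !rmorphM /= !rmorphXn -xQ -xP mulrAC.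
have Q0 := laurent_poly_neq0 x0 xQ; have P0 := laurent_poly_neq0 x0 xP.
have Xn0 m : ('X^m : {poly F}) != 0 by rewrite -size_poly_eq0 size_polyXn.
have := congr1 poly_spread QP.
by rewrite !poly_spreadM // !poly_spreadXn !addn0.
Qed.

(** The numerator of [x] is divided by that of [y] stripped of its powers of ['X]. The stripped
    divisor has size one more than its spread, so a remainder of smaller size also has smaller
    spread. *)
Lemma laurent_euclidean : euclidean_norm laurent_spread.
Proof.
have Xn0 m : ('X^m : {poly F}) != 0 by rewrite -size_poly_eq0 size_polyXn.
have [s st] := laurent_tV.
have stn n : s ^+ n * t ^+ n = 1 by rewrite -exprMn st expr1n.
have strip P : P != 0 -> exists Q, P = Q * 'X^(mup 0 P)
    /\ size Q = (poly_spread P).+1.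
  move=> P0; have := mup_geq 0 (mup 0 P) P0; rewrite leqnn subr0 => /esym.
  case/dvdpP=> Q PQ; exists Q; split=> //.
  have Q0 : Q != 0 by apply: contraNneq P0 => Q0; rewrite PQ Q0 mul0r.
  have := poly_spreadK P0; rewrite {3}PQ size_mul // size_polyXn addnS /=.
  have := Q0; rewrite -size_poly_gt0; case: (size Q) => // k _.
  by rewrite addSn /= => /eqP; rewrite eqn_add2r => /eqP ->.
split=> [|x y x0 y0|x x0|x y y0 yNx].
- exact: laurent_integral.
- have [P [m xP]] := laurent_polyP x; have [Q [n yQ]] := laurent_polyP y.
  rewrite (laurent_spreadE x0 xP) (laurent_spreadE y0 yQ) -poly_spreadM.
  + apply: (@laurent_spreadE _ _ (m + n)) => [/laurent_integral[]//|].
    by rewrite rmorphM /= -xP -yQ exprD mulrACA.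
  + exact: laurent_poly_neq0 xP.
  + exact: laurent_poly_neq0 yQ.
- have [P [m xP]] := laurent_polyP x; rewrite (laurent_spreadE x0 xP) => P0.
  have [Q [PQ]] := strip P (laurent_poly_neq0 x0 xP).
  rewrite P0 => /eqP/size_poly1P[c c0 QE].
  (* Spread 0 makes [x] a monomial, whose inverse is written down with the inverse [s] of [t]. *)
  exists (t ^+ m * s ^+ mup 0 P * lop (c^-1)%:P).
  rewrite !mulrA xP {1}PQ rmorphM rmorphXn /= -[_ * t ^+ _ * _]mulrA.
  by rewrite [t ^+ _ * _]mulrC stn mulr1 QE -rmorphM -polyCM mulfV // rmorph1.
have [P [m xP]] := laurent_polyP x; have [Q [n yQ]] := laurent_polyP y.
have [Q' [QQ' szQ']] := strip Q (laurent_poly_neq0 y0 yQ).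
have Q'0 : Q' != 0 by rewrite -size_poly_gt0 szQ'.
rewrite (laurent_spreadE y0 yQ).
have Q'y : lop Q' = y * t ^+ n * s ^+ mup 0 Q.
  by rewrite yQ {1}QQ' rmorphM rmorphXn /= -mulrA [t ^+ _ * _]mulrC stn mulr1.
pose q := lop (P %/ Q') * s ^+ m * t ^+ n * s ^+ mup 0 Q.
have xE : x - q * y = lop (P %% Q') * s ^+ m.
  have -> : x = lop P * s ^+ m by rewrite -xP -mulrA [t ^+ _ * _]mulrC stn mulr1.
  rewrite {1}(divp_eq P Q') rmorphD rmorphM /= Q'y /q; ring.
have r0 : x - q * y <> 0.
  by move=> /eqP; rewrite subr_eq0 => /eqP xqy; apply: yNx; exists q.
exists q; split=> //.
have rE : (x - q * y) * t ^+ m = lop (P %% Q') by rewrite xE -mulrA stn mulr1.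
rewrite (laurent_spreadE r0 rE) -ltnS -szQ'.
apply: leq_ltn_trans (ltn_modpN0 P Q'0); rewrite -[X in (_ <= X)%N]prednK.
  by rewrite ltnS leq_subr.
by rewrite size_poly_gt0; apply: laurent_poly_neq0 rE.
Qed.

End LaurentRing.

(** * Image and kernel of the evaluation at [theta] *)

Section LaurentEval.
Variables (F : fieldType) (E : fieldExtType F) (theta : E).
Variable theta_neq0 : theta != 0.
Local Notation ev := (laurent_eval theta_neq0).
Local Notation lop := (@laurent_of_poly F).

Lemma laurent_eval_poly P : ev (lop P) = (map_poly (in_alg E) P).[theta].
Proof.
have PE : laurent_val (lop P) * FracField.tofrac 'X ^+ 0 = FracField.tofrac P.
  by rewrite mulr1.
by have := laurent_evalE theta_neq0 PE; rewrite mulr1.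
Qed.

Lemma laurent_eval_surj : <<1; theta>>%VS = {:E}%VS -> forall y, exists x, ev x = y.
Proof.
move=> theta_gen y; have /Fadjoin1_polyP[P ->] : y \in <<1; theta>>%VS.
  by rewrite theta_gen memvf.
by exists (lop P); rewrite laurent_eval_poly.
Qed.

Lemma laurent_eval_eq0 (h : {poly F}) :
  minPoly 1 theta = map_poly (in_alg E) h ->
  forall x, ev x = 0 <-> divides (lop h) x.
Proof.
move=> hE x; split=> [x0|[c ->]]; last first.
  by rewrite rmorphM /= laurent_eval_poly -hE minPolyxx mulr0.
have [P [n xP]] := laurent_polyP x; have [s st] := laurent_tV F.
have : root (map_poly (in_alg E) P) theta.
  by rewrite /root -laurent_eval_poly -xP rmorphM /= x0 mul0r.
move/(minPoly_dvdp (alg_polyOver 1 P)); rewrite hE dvdp_map => /dvdpP[Q PQ].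
exists (lop Q * s ^+ n); rewrite mulrAC -rmorphM -PQ /= -xP -mulrA.
by rewrite -exprMn [_ * s]mulrC st expr1n mulr1.
Qed.

End LaurentEval.

(** * Counting the summands isomorphic to the quotient by [h] by means of homomorphisms to [E] *)

Section TorsionDual.
Variables (F : fieldType) (E : fieldExtType F) (theta : E).
Variable theta_neq0 : theta != 0.
Local Notation L := (laurent F).
Local Notation ev := (laurent_eval theta_neq0).
Variables (h : L) (h_neq0 : h <> 0).
Hypothesis ev_eq0 : forall x, ev x = 0 <-> divides h x.

Definition ev_linear (M : lmodType L) (f : M -> E) :=
  linear_for (ev \; *%R) f.

Lemma ev_linear0 (M : lmodType L) (f : M -> E) : ev_linear f -> f 0 = 0.
Proof.
by move=> fL; have := fL (-1) 0 0; rewrite scaler0 add0r /= rmorphN1 mulN1r addNr.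
Qed.

Lemma ev_linearZ (M : lmodType L) (f : M -> E) a x :
  ev_linear f -> f (a *: x) = ev a * f x.
Proof. by move=> fL; rewrite -[a *: x]addr0 fL (ev_linear0 fL) addr0. Qed.

Lemma ev_linearD (M : lmodType L) (f : M -> E) x y :
  ev_linear f -> f (x + y) = f x + f y.
Proof. by move=> fL; have := fL 1 x y; rewrite scale1r /= rmorph1 mul1r. Qed.

(* Evaluation at the family e identifies Hom(M, E), modulo the homomorphisms
   that vanish on the h-torsion of M, with E^k. *)
Definition torsion_dual (M : lmodType L) (k : nat) : Prop :=
  exists (I : finType) (e : I -> M),
  [/\ #|I| = k, forall i, h *: e i = 0,
      forall f, ev_linear f -> (forall i, f (e i) = 0) ->
        forall x, h *: x = 0 -> f x = 0
    & forall c : I -> E, exists f, ev_linear f /\ forall i, f (e i) = c i].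

Lemma torsion_dual_iso (M N : lmodType L) k :
  lmod_isomorphic M N -> torsion_dual N k -> torsion_dual M k.
Proof.
move=> [phi [psi phiK psiK]] [I [e [Ik he e_sep e_surj]]].
have psiL : linear psi.
  by move=> a x y; apply: (can_inj phiK); rewrite linearP !psiK.
have psiZ : scalable psi := @linearZ_LR _ _ _ _ (linear_of psiL).
have psi0 : psi 0 = 0 := linear0 (linear_of psiL).
exists I, (fun i => psi (e i)); split=> // [i|f fL f0 x hx|c].
- by rewrite -psiZ he psi0.
- have fpsiL : ev_linear (fun y => f (psi y)).
    by move=> a y z /=; rewrite psiL fL.
  by rewrite -[x]phiK (e_sep _ fpsiL) // -linearZ hx linear0.
have [f [fL fe]] := e_surj c.
exists (f \o phi); split=> [a x y|i]; first by rewrite /= linearP fL.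
by rewrite /= psiK fe.
Qed.

Lemma torsion_dual_prod (M N : lmodType L) j k :
  torsion_dual M j -> torsion_dual N k -> torsion_dual (M * N)%type (j + k).
Proof.
move=> [I [e [Ij he e_sep e_surj]]] [I' [e' [I'k he' e'_sep e'_surj]]].
exists (I + I')%type,
  (fun i => match i with inl i => (e i, 0) | inr i => (0, e' i) end).
split=> [|[] i|f fL f0 [x y] [hx hy]|c].
- by rewrite card_sum Ij I'k.
- by congr (_, _); rewrite ?he ?scaler0.
- by congr (_, _); rewrite ?he' ?scaler0.
- have -> : (x, y) = (x, 0) + (0, y).
    by congr (_, _); rewrite /= ?addr0 ?add0r.
  rewrite (ev_linearD _ _ fL) (e_sep (fun x => f (x, 0))) //; last first.
  + by move=> i; apply: (f0 (inl i)).
  + move=> a u u'; rewrite /= -fL; congr (f (_, _)).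
    by rewrite /= scaler0 addr0.
  rewrite (e'_sep (fun x => f (0, x))) ?addr0 //; last first.
  + by move=> i; apply: (f0 (inr i)).
  + move=> a u u'; rewrite /= -fL; congr (f (_, _)).
    by rewrite /= scaler0 addr0.
have [f [fL fe]] := e_surj (fun i => c (inl i)).
have [f' [f'L fe']] := e'_surj (fun i => c (inr i)).
exists (fun x => f x.1 + f' x.2); split=> [a x y|[i|i]] /=.
- by rewrite fL f'L /= mulrDr addrACA.
- by rewrite fe (ev_linear0 f'L) addr0.
- by rewrite fe' (ev_linear0 fL) add0r.
Qed.

Lemma torsion_dual0 (M : lmodType L) :
  (forall f, ev_linear f -> forall x : M, h *: x = 0 -> f x = 0) ->
  torsion_dual M 0.
Proof.
move=> M0; exists 'I_0, (fun=> 0); split=> [|[]|f fL _|c] //.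
- exact: card_ord.
- exact: M0.
by exists (fun=> 0); split=> [a x y|[]] //=; rewrite mulr0 addr0.
Qed.

Lemma torsion_dual_free r : torsion_dual 'rV[L]_r 0.
Proof.
apply: torsion_dual0 => f fL x /rowP hx.
suff -> : x = 0 by apply: ev_linear0.
apply/rowP=> i; have := hx i; rewrite !mxE => /laurent_integral[//|//].
Qed.

(** The single coordinate is the value at the class of 1; multiples of [ev], which factors through
    the quotient by [h], realize every value. *)
Lemma torsion_dual_cyclic : torsion_dual (cyclic_module h) 1.
Proof.
have pi_eq (x y : L^o) : span_pi (fun _ : unit => h : L^o) x = span_pi _ y ->
    ev x = ev y.
  move=> /span_piP/in_span_cyclic/ev_eq0 xy; apply/eqP; rewrite -subr_eq0.
  by rewrite -rmorphB; apply/eqP.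
pose e := span_pi (fun _ : unit => h : L^o) 1.
have eZ (x : cyclic_module h) : x = (repr x : L) *: e.
  rewrite /e -linearZ /= -[in LHS](span_piK x); congr span_pi.
  by rewrite /GRing.scale /= mulr1.
exists unit, (fun=> e); split=> [|_|f fL f0 x _|c].
- exact: card_unit.
- rewrite -linearZ; apply/cyclic_pi_eq0; exists 1.
  by rewrite /GRing.scale /= mulrC.
- by rewrite [x]eZ (ev_linearZ _ _ fL) (f0 tt) mulr0.
exists (fun x => ev (repr x) * c tt); split=> [a x y|[]] /=.
  rewrite mulrA -mulrDl -rmorphM -rmorphD; congr (_ * _); apply: pi_eq.
  by rewrite span_piK -{1}(span_piK x) -{1}(span_piK y) -linearP.
have -> : ev (repr e) = ev 1 by apply: pi_eq; rewrite span_piK.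
by rewrite rmorph1 mul1r.
Qed.

(** If [ev pi] is not 0, every homomorphism to [E] vanishes. Otherwise [pi] is a unit times [h]: for
    [e = 1] the module is the quotient by [h], and for larger [e] its [h]-torsion consists of
    multiples of [h], which act as 0 on [E]. *)
Lemma torsion_dual_primary pi e : irreducible pi -> (0 < e)%N ->
  torsion_dual (cyclic_module (pi ^+ e))
    `[< lmod_isomorphic (cyclic_module (pi ^+ e)) (cyclic_module h) >].
Proof.
move=> pi_irr e_gt0; case: asboolP => [isoh|noniso].
  exact: torsion_dual_iso isoh torsion_dual_cyclic.
apply: torsion_dual0 => f fL x hx.
have f_pi (y : L) : f (span_pi _ (y : L^o)) = ev y * f (span_pi _ (1 : L^o)).
  rewrite -(ev_linearZ _ _ fL) -linearZ; congr (f (span_pi _ _)).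
  by rewrite /GRing.scale /= mulr1.
rewrite -(span_piK x) f_pi; set y := repr x.
have [z hyE] : divides (pi ^+ e) (h * y).
  apply/cyclic_pi_eq0.
  have -> : span_pi (fun _ : unit => pi ^+ e : L^o) (h * y) = h *: span_pi _ y.
    by rewrite -linearZ.
  by rewrite span_piK.
case: (EM (ev pi = 0)) => [/ev_eq0[u piE]|evpi]; last first.
  have := f_pi (pi ^+ e).
  have -> : span_pi (fun _ : unit => pi ^+ e : L^o) (pi ^+ e) = 0.
    by apply/cyclic_pi_eq0; exists 1; rewrite mul1r.
  rewrite (ev_linear0 fL) rmorphXn => /esym/eqP; rewrite mulf_eq0 => /orP[|/eqP->].
    by rewrite expf_eq0 e_gt0 => /eqP.
  by rewrite mulr0.
have evh : ev h = 0 by apply/ev_eq0; exists 1; rewrite mul1r.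
have u_inv : invertible u.
  have [_ _ /(_ _ _ piE)[//|[h' hh']]] := pi_irr.
  have := congr1 ev hh'; rewrite rmorphM /= evh mul0r rmorph1.
  by move/eqP; rewrite eq_sym oner_eq0.
suff -> : ev y = 0 by rewrite mul0r.
move: (y : L) hyE => {f fL f_pi x hx}y.
case: e e_gt0 noniso => // -[|e] _ noniso.
  move=> _; case: noniso; rewrite expr1.
  apply: cyclic_module_associated; last by exists u.
  by case: u_inv => u' uu'; exists u'; rewrite piE mulrA [u' * _]mulrC uu' mul1r.
(* The exponent is now [e.+2]: cancelling one factor [h] still leaves one in [y]. *)
move=> hyE; have -> : y = z * u ^+ e.+2 * h ^+ e * h.
  apply: (eucl_mulIf (laurent_euclidean F) h_neq0).
  by rewrite mulrC hyE piE exprMn !exprSr !mulrA.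
by rewrite rmorphM /= evh mulr0.
Qed.

Lemma torsion_dual_primary_sum r s :
  (forall pi e, (pi, e) \in s -> irreducible pi /\ (0 < e)%N) ->
  torsion_dual (primary_sum r s)
    (count (fun pe => `[< lmod_isomorphic (cyclic_module (pe.1 ^+ pe.2))
                                          (cyclic_module h) >]) s).
Proof.
elim: s => [|[pi e] s IHs] s_irr; first exact: torsion_dual_free.
have [pi_irr e_gt0] := s_irr pi e (mem_head _ _).
apply: torsion_dual_prod; first exact: torsion_dual_primary.
by apply: IHs => pi' e' ins; apply: s_irr; rewrite inE ins orbT.
Qed.

(** The count holds for whichever decomposition [xget] selects, and the existence of a decomposition
    rules out the default value. *)
Lemma torsion_dual_multiplicity (M : lmodType L) n (g : 'I_n -> M) :
  (forall x, spanned g x) -> torsion_dual M (primary_multiplicity M h).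
Proof.
move=> /(primary_decomposition_exists (laurent_euclidean F))[r [s rs]].
rewrite /primary_multiplicity; case: xgetP => [k -> [r' [s' [[s'_irr Miso] ->]]]|].
  by apply: torsion_dual_iso Miso _; apply: torsion_dual_primary_sum.
move=> /(_ (count (fun pe => `[< lmod_isomorphic
  (cyclic_module (pe.1 ^+ pe.2)) (cyclic_module h) >]) s))[].
by exists r, s.
Qed.

End TorsionDual.

(** * The [h]-torsion of the Alexander module and the left kernel of the relation matrix at
    [theta] *)

Section TorsionOfDiagram.
Variables (F : fieldType) (E : fieldExtType F) (theta : E).
Variables (theta_neq0 : theta != 0) (D : diagram).
Local Notation L := (laurent F).
Local Notation t := (laurent_t F).
Local Notation ev := (laurent_eval theta_neq0).
Local Notation lop := (@laurent_of_poly F).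
Local Notation relator := (@crossing_relator F D).

Variable h : {poly F}.
Hypothesis ev_surj : forall y, exists x, ev x = y.
Hypothesis ev_eq0 : forall x, ev x = 0 <-> divides (lop h) x.
Hypothesis h_sep : ev (lop h^`()) != 0.

Lemma common_denominator (I : finType) (x : I -> L) :
  exists N (P : I -> {poly F}), forall i, x i * t ^+ N = lop (P i).
Proof.
have [f fE] := choice (fun i => laurent_polyP (x i)).
have [n nE] := choice fE; exists (\sum_i n i)%N.
exists (fun i => f i * 'X^(\sum_i n i - n i)) => i.
rewrite rmorphM rmorphXn /= -nE -mulrA -exprD subnKC //.
by rewrite (bigD1 i) //= leq_addr.
Qed.

Lemma sum_delta (V : pzRingType) (I : finType) (i : I) (f : I -> V) :
  \sum_j (j == i)%:R * f j = f i.
Proof.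
by rewrite (bigD1 i) //= eqxx mul1r big1 ?addr0 // => j /negPf->; rewrite mul0r.
Qed.

(** The entries of the relators as genuine polynomials, so that they can be differentiated. *)
Definition relator_poly (c : crossing D) (a : Defs.arc D) : {poly F} :=
  (a == lambda c)%:R - ('X * (a == rho c)%:R + (1 - 'X) * (a == omega c)%:R).

Lemma relator_polyE c a : relator c a = lop (relator_poly c a).
Proof.
rewrite /crossing_relator /relator_poly !ffunE /GRing.scale /=.
by rewrite !(rmorphB, rmorphD, rmorphM) /= !rmorph_nat rmorph1.
Qed.

Lemma scale_relator (b : L) c a :
  (b *: relator c) a = b * lop (relator_poly c a).
Proof. by rewrite ffunE relator_polyE. Qed.

Lemma eval_relator (u : Defs.arc D -> E) c :
  \sum_a ev (lop (relator_poly c a)) * u a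
  = u (lambda c) - (theta * u (rho c) + (1 - theta) * u (omega c)).
Proof.
have evE a : ev (lop (relator_poly c a)) = (a == lambda c)%:R
    - (theta * (a == rho c)%:R + (1 - theta) * (a == omega c)%:R).
  rewrite !(rmorphB, rmorphD, rmorphM) /= !rmorph_nat !rmorph1.
  by rewrite -/(laurent_t F) laurent_eval_t.
under eq_bigr do rewrite evE mulrBl mulrDl -!mulrA.
by rewrite sumrB big_split /= -!mulr_sumr !sum_delta.
Qed.

Lemma eval_deriv_relator (u : Defs.arc D -> E) c :
  \sum_a ev (lop (relator_poly c a)^`()) * u a = u (omega c) - u (rho c).
Proof.
have evE a : ev (lop (relator_poly c a)^`())
    = (a == omega c)%:R - (a == rho c)%:R.
  have -> : (relator_poly c a)^`() = (a == omega c)%:R - (a == rho c)%:R.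
    have dn n : (n%:R : {poly F})^`() = 0 by rewrite -polyC_natr derivC.
    by rewrite /relator_poly !(derivB, derivD, derivM, derivX, dn, dn 1%N); ring.
  by rewrite !rmorphB /= !rmorph_nat.
under eq_bigr do rewrite evE mulrBl.
by rewrite sumrB !sum_delta.
Qed.

(* Differentiate h X = sum_c C c *: relator c at theta, after clearing
   denominators. *)
Lemma deriv_relation (u : Defs.arc D -> E) (X : {ffun Defs.arc D -> L^o})
    (C : crossing D -> L) :
  (forall c, u (lambda c) - (theta * u (rho c) + (1 - theta) * u (omega c)) = 0) ->
  lop h *: X = \sum_c C c *: relator c ->
  ev (lop h^`()) * \sum_a ev (X a) * u a
  = \sum_c ev (C c) * (u (omega c) - u (rho c)).
Proof.
move=> u_col hX.
have [N [PQ PQE]] := common_denominator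
  (fun i : Defs.arc D + crossing D => match i with inl a => X a | inr c => C c end).
pose P a := PQ (inl a); pose Q c := PQ (inr c).
have PE a : X a * t ^+ N = lop (P a) := PQE (inl a).
have QE c : C c * t ^+ N = lop (Q c) := PQE (inr c).
have tN : ev (t ^+ N) != 0 by rewrite rmorphXn /= laurent_eval_t expf_neq0.
have evPX a : ev (X a) * ev (t ^+ N) = ev (lop (P a)) by rewrite -rmorphM PE.
have evQC c : ev (C c) * ev (t ^+ N) = ev (lop (Q c)) by rewrite -rmorphM QE.
have hP a : h * P a = \sum_c Q c * relator_poly c a.
  apply: laurent_of_poly_inj; rewrite rmorphM /= -PE mulrA.
  have /ffunP/(_ a) := hX; rewrite !ffunE /GRing.scale /= => ->.
  rewrite sum_ffunE mulr_suml rmorph_sum; apply: eq_bigr => c _.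
  rewrite scale_relator rmorphM /= -QE; ring.
have evh : ev (lop h) = 0 by apply/ev_eq0; exists 1; rewrite mul1r.
have hP' a : ev (lop h^`()) * ev (lop (P a)) =
    \sum_c (ev (lop (Q c)^`()) * ev (lop (relator_poly c a))
            + ev (lop (Q c)) * ev (lop (relator_poly c a)^`())).
  have /(congr1 (fun p => ev (lop p^`()))) := hP a.
  rewrite derivM rmorphD !rmorphM /= rmorphD !rmorphM /= evh mul0r addr0 => ->.
  rewrite linear_sum !rmorph_sum; apply: eq_bigr => c _.
  by rewrite /= derivM rmorphD !rmorphM /= rmorphD !rmorphM.
apply: (mulIf tN); rewrite -mulrA !mulr_suml.
under eq_bigr do rewrite mulrAC evPX.
under [RHS]eq_bigr do rewrite mulrAC evQC.
rewrite mulr_sumr; transitivity (\sum_a \sum_c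
    (ev (lop (Q c)^`()) * ev (lop (relator_poly c a))
     + ev (lop (Q c)) * ev (lop (relator_poly c a)^`())) * u a).
  by apply: eq_bigr => a _; rewrite mulrA hP' mulr_suml.
rewrite exchange_big; apply: eq_bigr => c _ /=.
under eq_bigr do rewrite mulrDl -!mulrA.
(* The terms that differentiate [Q c] carry the relator itself, which vanishes on the colouring
   [u]. *)
rewrite big_split /= -!mulr_sumr eval_relator u_col mulr0 add0r.
by rewrite eval_deriv_relator.
Qed.

Definition left_kernel (nu : crossing D -> E) : Prop :=
  forall u : Defs.arc D -> E, \sum_c nu c *
    (u (lambda c) - (theta * u (rho c) + (1 - theta) * u (omega c))) = 0.

Lemma eval_combination (u : Defs.arc D -> E) (C : crossing D -> L) :
  \sum_a ev ((\sum_c C c *: relator c) a) * u a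
  = \sum_c ev (C c) *
      (u (lambda c) - (theta * u (rho c) + (1 - theta) * u (omega c))).
Proof.
under eq_bigr => a _.
  rewrite sum_ffunE rmorph_sum mulr_suml.
  under eq_bigr do rewrite scale_relator rmorphM /=.
  over.
rewrite exchange_big; apply: eq_bigr => c _ /=.
under eq_bigr do rewrite -mulrA.
by rewrite -mulr_sumr -eval_relator.
Qed.

Lemma rep_span_pi (f : Rep theta_neq0 D) (X : {ffun Defs.arc D -> L^o}) :
  f (span_pi relator X) = \sum_a ev (X a) * f (alexander_gen F a).
Proof.
have {1}-> : X = \sum_a (X a : L) *: free_gen F a.
  apply/ffunP=> b; rewrite sum_ffunE.
  under eq_bigr do rewrite !ffunE /GRing.scale /= mulrC eq_sym.
  by rewrite (sum_delta b X).
rewrite /rep_fun !linear_sum; apply: eq_bigr => a _.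
by rewrite !linearZ.
Qed.

Lemma rep_relation (f : Rep theta_neq0 D) c :
  f (alexander_gen F (lambda c)) - (theta * f (alexander_gen F (rho c))
    + (1 - theta) * f (alexander_gen F (omega c))) = 0.
Proof.
have := rep_colouringP f; rewrite memv_ker lfunE => /eqP/ffunP/(_ c).
by rewrite !ffunE.
Qed.

Lemma kills_torsionP (f : Rep theta_neq0 D) :
  (forall x : alexander_module F D, lop h *: x = 0 -> f x = 0) <->
  (forall nu, left_kernel nu -> \sum_c nu c *
    (f (alexander_gen F (omega c)) - f (alexander_gen F (rho c))) = 0).
Proof.
split=> [f_tors nu nu_ker|f_ker x hx].
  have [C CE] := choice (fun c => ev_surj (nu c)).
  pose Z := \sum_c C c *: relator c.
  (* The kernel condition, tested on the indicator of the arc [a], says [ev (Z a) = 0]. *)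
  have /choice[X XE] a : exists y, Z a = y * lop h.
    apply/ev_eq0; rewrite -[LHS](sum_delta a (fun b => ev (Z b))).
    under eq_bigr do rewrite mulrC.
    rewrite eval_combination -[RHS](nu_ker (fun b => (b == a)%:R)).
    by apply: eq_bigr => c _; rewrite CE.
  pose X' : {ffun Defs.arc D -> L^o} := [ffun a => X a].
  have hX : lop h *: X' = Z.
    by apply/ffunP=> a; rewrite !ffunE XE /GRing.scale /= mulrC.
  under eq_bigr do rewrite -CE.
  have := @deriv_relation (fun a => f (alexander_gen F a)) _ _
    (rep_relation f) hX.
  rewrite -rep_span_pi f_tors.
    by rewrite mulr0 => <-.
  rewrite -linearZ hX -(linear0 (span_pi relator)).
  by apply/span_piP/asboolP; exists C; rewrite subr0.
have /span_piP/asboolP[C] : span_pi relator (lop h *: repr x) = span_pi relator 0.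
  by rewrite linearZ linear0 /= span_piK.
rewrite subr0 => hX.
have C_ker : left_kernel (fun c => ev (C c)).
  move=> u; rewrite -eval_combination -hX big1 // => a _.
  rewrite !ffunE /GRing.scale /= rmorphM /=.
  have -> : ev (lop h) = 0 by apply/ev_eq0; exists 1; rewrite mul1r.
  by rewrite !mul0r.
have := @deriv_relation (fun a => f (alexander_gen F a)) _ _ (rep_relation f) hX.
rewrite (f_ker _ C_ker) -rep_span_pi span_piK => /eqP.
by rewrite mulf_eq0 (negPf h_sep) => /eqP.
Qed.

End TorsionOfDiagram.

(** The columns of the cokernel matrix kill the image, and together they detect membership in it. *)
Lemma fredholm (E : fieldType) m n (phi : 'rV[E]_m -> 'rV[E]_n) (w : 'rV_n) :
  linear phi ->
  (forall mu : 'cV_n, (forall v, phi v *m mu = 0) -> w *m mu = 0) ->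
  exists v, phi v = w.
Proof.
move=> phiL w_mu; pose A := lin1_mx (linear_of phiL).
have phiE v : phi v = v *m A by rewrite mul_rV_lin1.
have /submxP[v wE] : (w <= A)%MS; last by exists v; rewrite phiE.
rewrite submxE; apply/eqP/matrixP=> i j.
have : w *m col j (cokermx A) = 0.
  apply: w_mu => v.
  by rewrite colE phiE mulmxA -[v *m A *m _]mulmxA mulmx_coker mulmx0 mul0mx.
by rewrite colE mulmxA -colE => /colP/(_ i); rewrite !mxE.
Qed.

(** * Transport of colours through one crossing *)

Section BraidStep.
Variables (E : fieldType) (th : E) (th_neq0 : th != 0).

(* The effect on the colours of the strings of a positive crossing at positions
   i and i.+1, with a defect d in the relation of the crossing. *)
Definition braid_step (a : E) (i : nat) (x : nat -> E) (d : E) (j : nat) : E :=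
  if j == i then a * x i.+1 + (1 - a) * x i + d
  else if j == i.+1 then x i else x j.

(** In closed form, [(1 - th)] times the sum of [th ^+ (j - 1 - k) * y k] over [k < j]. *)
Fixpoint twisted_sum (y : nat -> E) (j : nat) : E :=
  if j is j'.+1 then th * twisted_sum y j' + (1 - th) * y j' else 0.

(* Intertwines the step for th^-1 with the transpose of the inverse of the step
   for th; see pairing_step. *)
Definition dual_state (y : nat -> E) (j : nat) : E := y j - twisted_sum y j.

Lemma eq_twisted_sum y y' j : (forall k, (k < j)%N -> y k = y' k) ->
  twisted_sum y j = twisted_sum y' j.
Proof.
elim: j => //= j IHj yy'; rewrite IHj ?yy' // => k kj.
by apply: yy'; apply: leq_trans kj _.
Qed.

Section Step.
Variables (i : nat) (y : nat -> E).
Local Notation y' := (braid_step th^-1 i y 0).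

Lemma step_lo a x d : braid_step a i x d i = a * x i.+1 + (1 - a) * x i + d.
Proof. by rewrite /braid_step eqxx. Qed.

Lemma step_hi a x d : braid_step a i x d i.+1 = x i.
Proof. by rewrite /braid_step eqxx -[X in _ == X]addn0 -addn1 eqn_add2l. Qed.

Lemma step_other a x d j : j != i -> j != i.+1 -> braid_step a i x d j = x j.
Proof. by rewrite /braid_step => /negPf-> /negPf->. Qed.

Lemma twisted_sum_lo : twisted_sum y' i = twisted_sum y i.
Proof.
by apply: eq_twisted_sum => k ki; rewrite step_other // ltn_eqF // ltnW.
Qed.

(** Beyond position [i.+1] the two altered colours enter only through [th * y i + y i.+1], which the
    step for [th^-1] preserves. *)
Lemma twisted_sum_step j : j != i.+1 -> twisted_sum y' j = twisted_sum y j.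
Proof.
rewrite neq_ltn ltnS => /orP[ji|].
  apply: eq_twisted_sum => k kj; have ki := leq_trans kj ji.
  by rewrite step_other // ltn_eqF // ltnW.
elim: j => // j IHj; rewrite ltnS leq_eqVlt => /predU1P[<-|ij].
  rewrite /= step_hi step_lo twisted_sum_lo; field.
  exact: th_neq0.
by rewrite /= IHj // step_other // gtn_eqF // ltnW.
Qed.

Lemma dual_step j : j != i -> j != i.+1 -> dual_state y' j = dual_state y j.
Proof.
by move=> ji ji1; rewrite /dual_state twisted_sum_step // step_other.
Qed.

Lemma dual_step_lo : dual_state y' i = th^-1 * dual_state y i.+1.
Proof.
rewrite /dual_state twisted_sum_lo step_lo /=; field.
exact: th_neq0.
Qed.

Lemma dual_step_hi :
  dual_state y' i.+1 = dual_state y i + (1 - th^-1) * dual_state y i.+1.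
Proof.
rewrite /dual_state /= twisted_sum_lo step_hi step_lo /=; field.
exact: th_neq0.
Qed.

Variables (m : nat) (im : (i.+1 < m)%N).

Lemma sum_step (G G' : nat -> E) :
  (forall j, j != i -> j != i.+1 -> G' j = G j) ->
  \sum_(j < m) G' j = \sum_(j < m) G j + (G' i + G' i.+1 - G i - G i.+1).
Proof.
move=> GG'; pose i0 := Ordinal (ltnW im); pose i1 := Ordinal im.
have i10 : i1 != i0 by rewrite -val_eqE /= eqn_leq ltnn.
rewrite (bigD1 i0) //= (bigD1 i1) //= [in RHS](bigD1 i0) //= [in RHS](bigD1 i1) //=.
rewrite (eq_bigr (fun j : 'I_m => G j)); first by ring.
by move=> j /andP[ji0 ji1]; apply: GG'.
Qed.

Definition pairing (x z : nat -> E) := \sum_(j < m) x j * dual_state z j.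

(** The dual state moves by the inverse transpose, so the pairing would be preserved but for the
    defect. *)
Lemma pairing_step x d :
  pairing (braid_step th i x d) y' = pairing x y + d * dual_state y' i.
Proof.
rewrite /pairing (@sum_step (fun j => x j * dual_state y j)
  (fun j => braid_step th i x d j * dual_state y' j)); last first.
  by move=> j ji ji1; rewrite dual_step // step_other.
rewrite step_lo step_hi dual_step_lo dual_step_hi; field.
exact: th_neq0.
Qed.

Variable x : nat -> E.
Local Notation x' := (braid_step th i x 0).

(** Without dualizing, the product changes by a combination of the summands of [form_ab] and
    [form_ba]; on a closed braid this relates the two forms. *)
Lemma dot_step : \sum_(j < m) x' j * y' j = \sum_(j < m) x j * y j
  + ((th^-1 - 1) * (x i * (y i.+1 - y i)) + (th - 1) * ((x i.+1 - x i) * y i)).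
Proof.
rewrite (@sum_step (fun j => x j * y j) (fun j => x' j * y' j)); last first.
  by move=> j ji ji1; rewrite !step_other.
rewrite !step_lo !step_hi; field.
exact: th_neq0.
Qed.

(** The weight [j] detects the exchange of adjacent positions: the increment ties a summand of
    [form_ab] to the gap [x i.+1 - x i] times the left weight. *)
Lemma weighted_step :
  \sum_(j < m) j%:R * (x' j * dual_state y' j)
  = \sum_(j < m) j%:R * (x j * dual_state y j)
    - (th^-1 * (x i * (y i.+1 - y i))
       + th * ((x i.+1 - x i) * dual_state y' i)).
Proof.
rewrite (@sum_step (fun j => j%:R * (x j * dual_state y j))
  (fun j => j%:R * (x' j * dual_state y' j))); last first.
  by move=> j ji ji1; rewrite dual_step // step_other.
rewrite !step_lo !step_hi dual_step_lo dual_step_hi /dual_state /=.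
rewrite -natr1; field.
exact: th_neq0.
Qed.

End Step.
End BraidStep.

(** * Transport of colours along a whole braid and its closure *)

Section BraidRun.
Variables (E : fieldType) (th : E) (th_neq0 : th != 0).
Variables (m N : nat) (w : nat -> nat).
Hypothesis w_lt : forall k, (k < N)%N -> ((w k).+1 < m)%N.

Definition evolves (a : E) (d : nat -> E) (X : nat -> nat -> E) : Prop :=
  forall k, (k < N)%N -> X k.+1 = braid_step a (w k) (X k) (d k).

Definition closes (X : nat -> nat -> E) : Prop := X (N) = X 0%N.

(** The coefficient of the [k]-th defect in [pairing_step]; it is read after the crossing, hence
    [k.+1]. *)
Definition left_weight (Y : nat -> nat -> E) (k : nat) : E :=
  dual_state th (Y k.+1) (w k).

Fixpoint run (a : E) (d : nat -> E) (x : nat -> E) (k : nat) : nat -> E :=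
  if k is k'.+1 then braid_step a (w k') (run a d x k') (d k') else x.

Lemma run_evolves a d x : evolves a d (run a d x).
Proof. by []. Qed.

Local Notation zero := (fun _ : nat => 0 : E).

Lemma pairing_evolves d X Y k : (k <= N)%N ->
  evolves th d X -> evolves th^-1 zero Y ->
  pairing th m (X k) (Y k)
  = pairing th m (X 0%N) (Y 0%N) + \sum_(l < k) d l * left_weight Y l.
Proof.
move=> + XE YE; elim: k => [|k IHk] kw; first by rewrite big_ord0 addr0.
rewrite XE // YE // pairing_step ?w_lt // -YE // IHk; last exact: ltnW.
by rewrite big_ord_recr addrA.
Qed.

Lemma run_linear a d d' x x' b k j :
  run a (fun l => b * d l + d' l) (fun l => b * x l + x' l) k j
  = b * run a d x k j + run a d' x' k j.
Proof.
elim: k j => //= k IHk j; rewrite /braid_step !IHk.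
by case: ifP => _; [ring | case: ifP].
Qed.

Lemma run_local a d x x' k : (k <= N)%N ->
  (forall j, (j < m)%N -> x j = x' j) ->
  forall j, (j < m)%N -> run a d x k j = run a d x' k j.
Proof.
move=> + xx'; elim: k => //= k IHk kw j jm; have km := w_lt kw.
rewrite /braid_step; case: ifP => _; last by case: ifP => _; rewrite !IHk // ltnW.
by rewrite !IHk // ltnW.
Qed.

Lemma run_outside a x k j : (k <= N)%N -> (m <= j)%N ->
  run a zero x k j = x j.
Proof.
move=> + mj; elim: k => //= k IHk kw; have km := w_lt kw.
rewrite step_other ?IHk 1?ltnW // gtn_eqF // (leq_trans _ mj) //.
exact: ltnW.
Qed.

Lemma run_surj a z k : a != 0 -> exists x, run a zero x k = z.
Proof.
move=> a0; elim: k z => [|k IHk] z; first by exists z.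
pose i := w k.
have [x xE] := IHk (fun j => if j == i then z i.+1
  else if j == i.+1 then a^-1 * (z i - (1 - a) * z i.+1) else z j).
exists x; apply: funext => j; rewrite /= xE /braid_step -/i eqxx.
have -> : (i.+1 == i) = false by apply: gtn_eqF.
rewrite eqxx; case: eqVneq => [->|_]; last by case: eqVneq => [->|].
field.
exact: a0.
Qed.

(** This exhibits an explicit preimage of [u] under [dual_state]. *)
Lemma twisted_sum_solve (u : nat -> E) j :
  twisted_sum th (fun j => u j + (1 - th) * \sum_(l < j) u l) j
  = (1 - th) * \sum_(l < j) u l.
Proof.
elim: j => [|j IHj]; first by rewrite big_ord0 mulr0.
by rewrite /= IHj big_ord_recr /=; ring.
Qed.

Lemma dual_state_inj y y' :
  (forall j, (j < m)%N -> dual_state th y j = dual_state th y' j) ->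
  forall j, (j < m)%N -> y j = y' j.
Proof.
move=> yy' j; have [n] := ubnP j; elim: n j => // n IHn j jn jm.
have := yy' j jm; rewrite /dual_state (@eq_twisted_sum _ _ y y').
  by move/addIr.
by move=> k kj; apply: IHn; [exact: leq_trans kj _ | exact: ltn_trans jm].
Qed.

(** Closing up amounts to solving a linear system for the initial colours. By [fredholm] the
    obstructions are covectors fixed by the transposed monodromy; through [dual_state] these are
    closed runs for [th^-1], against which [d] is assumed orthogonal. *)
Theorem closed_run_exists (d : nat -> E) :
  (forall Y, evolves th^-1 zero Y -> closes Y ->
     \sum_(k < N) d k * left_weight Y k = 0) ->
  exists X, evolves th d X /\ forall j, (j < m)%N -> X (N) j = X 0%N j.
Proof.
move=> dY.
pose ext (v : 'rV[E]_m) (j : nat) : E :=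
  if insub j is Some j' then v 0 j' else 0.
have extE v (j : 'I_m) : ext v j = v 0 j by rewrite /ext valK.
pose phi (v : 'rV[E]_m) := \row_(j < m) (run th zero (ext v) N j - ext v j).
have extL b u v : ext (b *: u + v) = fun j => b * ext u j + ext v j.
  apply: funext => j; rewrite /ext; case: insubP => [j' _ _|_].
    by rewrite !mxE.
  by rewrite mulr0 addr0.
have phiL : linear phi.
  move=> b u v; apply/rowP=> j; rewrite !mxE extL.
  have := run_linear th zero zero (ext u) (ext v) b N j.
  have -> : (fun _ : nat => b * 0 + 0) = zero.
    by apply: funext => l; rewrite mulr0 addr0.
  by move->; ring.
have [|v vE] := @fredholm _ _ _ phi (\row_(j < m) - run th d zero N j) phiL.
  move=> mu mu0; pose u := ext mu^T.
  pose y0 (j : nat) := u j + (1 - th) * \sum_(l < j) u l.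
  have dual_y0 j : dual_state th y0 j = u j.
    by rewrite /dual_state twisted_sum_solve addrK.
  have muE x : (\row_(j < m) x (nat_of_ord j)) *m mu = (pairing th m x y0)%:M.
    apply/matrixP=> i j; rewrite !ord1 !mxE eqxx mulr1n; apply: eq_bigr => l _.
    by rewrite !mxE dual_y0 /u extE mxE.
  pose Y := run th^-1 zero y0.
  have YE : evolves th^-1 zero Y by exact: run_evolves.
  have YN j : (j < m)%N -> Y N j = y0 j.
    move: j; apply: dual_state_inj => j jm.
    (* Starting colours [x] whose run ends at the [j]-th unit vector let the pairing read off the
       [j]-th dual coordinate of [Y N]. *)
    have [x xE] := run_surj (fun l => (l == j)%:R) N th_neq0.
    have pick z : pairing th m (fun l => (l == j)%:R) z = dual_state th z j.
      rewrite /pairing (bigD1 (Ordinal jm)) //= eqxx mul1r big1 ?addr0 //.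
      by move=> l /negPf lj; rewrite [_ == _]lj mul0r.
    rewrite -!pick -{1}xE (pairing_evolves (leqnn _) (run_evolves th zero x) YE).
    rewrite big1 ?addr0 => [|l _]; last by rewrite mul0r.
    pose x' := \row_(l < m) x l.
    have xx' l : (l < m)%N -> x l = ext x' l.
      by move=> lm; have := extE x' (Ordinal lm); rewrite mxE /= => ->.
    have := mu0 x'; have -> : phi x' = \row_(l < m) (run th zero x N l - x l).
      apply/rowP=> l; rewrite !mxE -xx' // -(@run_local _ _ x) //.
    rewrite (muE (fun l => run th zero x N l - x l)) => /matrixP/(_ 0 0).
    rewrite !mxE eqxx mulr1n xE /pairing => /eqP.
    under eq_bigr do rewrite mulrBl.
    by rewrite sumrB subr_eq0 => /eqP.
  have Yclose : closes Y.
    apply: funext => j; case: (ltnP j m) => [/YN //|mj].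
    exact: run_outside.
  (* Started from zero colours, the final pairing is the sum of defects times left weights, which
     vanishes. *)
  have := pairing_evolves (leqnn _) (run_evolves th d zero) YE.
  rewrite (dY Y YE Yclose) addr0 => dE.
  rewrite (muE (fun j => - run th d zero N j)).
  have -> : pairing th m (fun j => - run th d zero N j) y0 = 0.
    transitivity (- pairing th m (run th d zero N) (Y N)).
      rewrite Yclose /pairing -sumrN; apply: eq_bigr => j _.
      by rewrite mulNr.
    by rewrite dE /pairing big1 ?oppr0 // => j _; rewrite mul0r.
  by apply/matrixP=> i j; rewrite !mxE mul0rn.
exists (run th d (ext v)); split=> [|j jm]; first exact: run_evolves.
have := run_linear th zero d (ext v) zero 1 N j.
have -> : (fun l : nat => 1 * 0 + d l) = d.
  by apply: funext => l; rewrite mulr0 add0r.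
have -> : (fun l : nat => 1 * ext v l + 0) = ext v.
  by apply: funext => l; rewrite mul1r addr0.
move=> ->; rewrite mul1r /=; have /rowP/(_ (Ordinal jm)) := vE.
rewrite !mxE /= => /eqP; rewrite subr_eq => /eqP->.
by rewrite addrC addrA addrN add0r.
Qed.

Lemma telescope_closed (V : zmodType) (G D : nat -> V) n :
  (forall k, (k < n)%N -> G k.+1 = G k + D k) -> G n = G 0%N ->
  \sum_(k < n) D k = 0.
Proof.
move=> GD; suff -> : G n = G 0%N + \sum_(k < n) D k.
  by move/(congr1 (fun z => - G 0%N + z)); rewrite addKr addNr.
elim: n GD => [|n IHn] GD; first by rewrite big_ord0 addr0.
by rewrite GD // IHn ?big_ord_recr ?addrA // => k /ltnW/GD.
Qed.

Section ClosedRuns.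
Variables X Y : nat -> nat -> E.
Hypotheses (XE : evolves th zero X) (YE : evolves th^-1 zero Y).
Hypotheses (XN : closes X) (YN : closes Y).

(** The difference [form_ba - form_ab] is the sum of the [x i.+1 * y i - x i * y i.+1], that is,
    [eta] without its constant. *)
Definition form_ba := \sum_(k < N)
  (X k (w k).+1 - X k (w k)) * Y k (w k).
Definition form_ab := \sum_(k < N)
  X k (w k) * (Y k (w k).+1 - Y k (w k)).

Lemma form_closed : (th^-1 - 1) * form_ab + (th - 1) * form_ba = 0.
Proof.
rewrite /form_ab /form_ba !mulr_sumr -big_split.
apply: (@telescope_closed _ (fun k => \sum_(j < m) X k j * Y k j) (fun k =>
  (th^-1 - 1) * (X k (w k) * (Y k (w k).+1 - Y k (w k)))
  + (th - 1) * ((X k (w k).+1 - X k (w k)) * Y k (w k)))) => [k kN|].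
  by rewrite XE // YE // dot_step // w_lt.
by rewrite XN YN.
Qed.

Lemma weighted_closed : th^-1 * form_ab + th * \sum_(k < N)
  ((X k (w k).+1 - X k (w k)) * left_weight Y k) = 0.
Proof.
rewrite /form_ab !mulr_sumr -big_split.
apply: oppr_inj; rewrite oppr0 -sumrN.
apply: (@telescope_closed _
  (fun k => \sum_(j < m) j%:R * (X k j * dual_state th (Y k) j)) (fun k =>
  - (th^-1 * (X k (w k) * (Y k (w k).+1 - Y k (w k)))
  + th * ((X k (w k).+1 - X k (w k)) * left_weight Y k)))) => [k kN|].
  by rewrite /left_weight XE // YE // weighted_step // w_lt.
by rewrite XN YN.
Qed.

Hypothesis th_neq1 : th != 1.

Lemma form_abE : form_ab = th * form_ba.
Proof.
have th10 : th - 1 != 0 by rewrite subr_eq0.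
apply: (mulfI th10); apply/eqP; rewrite -subr_eq0; apply/eqP.
rewrite -[RHS](mulr0 (- th)) -form_closed; field.
exact: th_neq0.
Qed.

(** Eliminating [form_ab] from the weighted identity makes [form_ba] equal to [- th] times the sum
    of gaps against left weights. *)
Lemma form_ba_eq0 : form_ba = 0 <->
  \sum_(k < N) (X k (w k).+1 - X k (w k)) * left_weight Y k = 0.
Proof.
have := weighted_closed; rewrite form_abE mulKf // => /eqP.
rewrite addr_eq0 => /eqP ->.
split=> [/eqP|->]; last by rewrite mulr0 oppr0.
by rewrite oppr_eq0 mulf_eq0 (negPf th_neq0) => /eqP.
Qed.

End ClosedRuns.

End BraidRun.

(** * The rank of a sesquilinear form whose radical is cut out by independent functionals *)

Section FormRank.
Variables (E : fieldType) (V : vectType E) (b : V -> V -> E) (s : E -> E).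
Hypothesis b_linl : forall w a x y, b (a *: x + y) w = a * b x w + b y w.
Hypothesis b_linr : forall w a x y, b w (a *: x + y) = s a * b w x + b w y.
Hypothesis b0 : forall w, b w 0 = 0.

Variables (I : finType) (phi : I -> V -> E).
Hypothesis phi_lin : forall i a x y, phi i (a *: x + y) = a * phi i x + phi i y.
Hypothesis phi_surj : forall c, exists x, forall i, phi i x = c i.
Hypothesis b_rad : forall x, (forall y, b x y = 0) <-> (forall i, phi i x = 0).

Lemma scalar_sum (f : V -> E) n (c : 'I_n -> E) (v : 'I_n -> V) :
  (forall a x y, f (a *: x + y) = a * f x + f y) ->
  f (\sum_i c i *: v i) = \sum_i c i * f (v i).
Proof.
move=> f_lin; have f0 : f 0 = 0.
  by have := f_lin (-1) 0 0; rewrite scaler0 add0r mulN1r addNr.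
elim/big_rec2: _ => [//|i y1 y2 _ <-].
by rewrite f_lin.
Qed.

(** The Gram matrix and the matrix [B] of the functionals have the same left kernel, hence the same
    rank; surjectivity of [phi] gives [B] full column rank. *)
Lemma form_rankE : form_rank b = #|I|.
Proof.
rewrite /form_rank; set G := \matrix_(i, j) _.
pose B := \matrix_(i < \dim {:V}, l < #|I|) phi (enum_val l) (vbasis {:V})`_i.
pose comb (x : 'rV[E]_(\dim {:V})) : V := \sum_i x 0 i *: (vbasis {:V})`_i.
have combE v : comb (\row_i coord (vbasis {:V}) i v) = v.
  rewrite {2}(coord_vbasis (memvf v)); apply: eq_bigr => i _.
  by rewrite mxE.
have mulG x j : (x *m G) 0 j = b (comb x) (vbasis {:V})`_j.
  rewrite mxE (scalar_sum _ _ (b_linl _)); apply: eq_bigr => i _.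
  by rewrite mxE.
have mulB x l : (x *m B) 0 l = phi (enum_val l) (comb x).
  rewrite mxE (scalar_sum _ _ (phi_lin _)); apply: eq_bigr => i _.
  by rewrite mxE.
have GB (x : 'rV_(\dim {:V})) : x *m G = 0 <-> x *m B = 0.
  split=> [xG|xB]; apply/rowP=> j; rewrite [RHS]mxE.
    rewrite mulB; apply: (b_rad _).1 => y.
    have : forall i : 'I_(\dim {:V}), b (comb x) (vbasis {:V})`_i = 0.
      by move=> i; rewrite -mulG xG mxE.
    move: (comb x) => z bz; rewrite -(combE y) /comb.
    elim/big_rec: _ => [|i y' _ y'0]; first exact: b0.
    by rewrite b_linr y'0 bz mulr0 addr0.
  rewrite mulG; apply: (b_rad _).2 => i.
  by have := mulB x (enum_rank i); rewrite xB mxE enum_rankK => <-.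
have rank_ker : \rank (kermx G) = \rank (kermx B).
  apply/eqP; rewrite eqn_leq !mxrankS //; apply/row_subP=> i.
    by apply/sub_kermxP/GB; rewrite -row_mul mulmx_ker row0.
  by apply/sub_kermxP/GB; rewrite -row_mul mulmx_ker row0.
have -> : \rank G = \rank B.
  move: rank_ker; rewrite !mxrank_ker => rk.
  by rewrite -(subKn (rank_leq_row G)) rk subKn ?rank_leq_row.
apply/eqP; rewrite -[_ == _]/(row_full B) -sub1mx; apply/row_subP=> l.
have [x xE] := phi_surj (fun i => row l 1%:M 0 (enum_rank i)).
apply/submxP; exists (\row_i coord (vbasis {:V}) i x).
by apply/rowP=> l'; rewrite mulB combE xE enum_valK.
Qed.

End FormRank.

(** * Arcs of a positive closed braid versus colours of its strings *)

Section PositiveBraid.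
Variables (m : nat) (w : seq ('I_m.-1 * bool)).
Hypothesis w_pos : forall k, (letter (w := w) k).2.
Variable E : fieldType.
Local Notation N := (size w).
Local Notation D := (closed_braid w).
Implicit Types (k : 'I_(size w)) (j : 'I_m).

Definition position (k : nat) : nat :=
  if insub k is Some c then val (letter (w := w) c).1 else 0%N.

Lemma positionE k : position k = (letter k).1.
Proof. by rewrite /position valK. Qed.

Lemma position_lt (n : nat) : (n < N)%N -> ((position n).+1 < m)%N.
Proof.
move=> nN; rewrite (positionE (Ordinal nN)).
exact: (ltn_ord (high (letter (Ordinal nN)).1)).
Qed.

(* Extended by 0 outside the braid. *)
Definition braid_state (u : Defs.arc D -> E) (k j : nat) : E :=
  if insub k is Some k' then
    if insub j is Some j' then u (arc_of (w := w) (k', j')) else 0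
  else 0.

Lemma braid_stateE u (k : 'I_N.+1) j : braid_state u k j = u (arc_of (k, j)).
Proof. by rewrite /braid_state !valK. Qed.

Lemma braid_state_below u k j : braid_state u k j = u (arc_of (below k j)).
Proof. exact: (braid_stateE u (widen_ord (leqnSn N) k)). Qed.

Lemma braid_state_above u k j : braid_state u k.+1 j = u (arc_of (above k j)).
Proof. exact: (braid_stateE u (lift ord0 k)). Qed.

Lemma braid_state_outside u (n l : nat) : (m <= l)%N -> braid_state u n l = 0.
Proof.
move=> mj; rewrite /braid_state; case: insubP => // k' _ _.
by case: insubP => // j'; rewrite ltnNge mj.
Qed.

Lemma joined_arc (x y : segment w) : joined x y -> arc_of x = arc_of y.
Proof.
move=> xy; apply/eqP; rewrite arc_of_eq; apply: connect1.
by rewrite xy.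
Qed.

Definition relation_defect (a : E) (u : Defs.arc D -> E) (c : crossing D) : E :=
  u (lambda c) - (a * u (rho c) + (1 - a) * u (omega c)).

Definition extend0 (d : 'I_N -> E) (k : nat) : E :=
  if insub k is Some c then d c else 0.

Lemma extend0E d k : extend0 d k = d k.
Proof. by rewrite /extend0 valK. Qed.

Lemma lowE k : low (letter k).1 = position k :> nat.
Proof. by rewrite positionE. Qed.

Lemma highE k : high (letter k).1 = (position k).+1 :> nat.
Proof. by rewrite positionE. Qed.

Lemma state_omega u k : braid_state u k (position k) = u (omega (d := D) k).
Proof.
by rewrite -lowE braid_state_below /= /over_in w_pos.
Qed.

Lemma state_rho u k : braid_state u k (position k).+1 = u (rho (d := D) k).
Proof.
by rewrite -highE braid_state_below /= w_pos /under_in /over_out w_pos.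
Qed.

Lemma state_lambda u k : braid_state u k.+1 (position k) = u (lambda (d := D) k).
Proof.
by rewrite -lowE braid_state_above /= w_pos /under_out /over_in w_pos.
Qed.

(** Here [u] is arbitrary: its failure to satisfy the relations is recorded as the defect at each
    crossing. *)
Lemma braid_state_evolves a u :
  evolves N position a (extend0 (relation_defect a u)) (braid_state u).
Proof.
move=> k' k'N; pose k := Ordinal k'N; rewrite -[k']/(val k); apply: funext => j.
rewrite extend0E; case: (eqVneq j (position k)) => [->|jlo].
  rewrite step_lo state_lambda state_rho state_omega /relation_defect.
  by rewrite addrC subrK.
case: (eqVneq j (position k).+1) => [->|jhi].
  rewrite step_hi -highE -lowE braid_state_above braid_state_below.
  congr u; apply/esym/joined_arc/orP; left; apply/existsP; exists k.
  by rewrite !eqxx /passes /over_in /over_out w_pos !eqxx.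
rewrite step_other //; case: (ltnP j m) => [jm|mj]; last first.
  by rewrite !braid_state_outside.
rewrite -[j]/(val (Ordinal jm)) braid_state_above braid_state_below.
congr u; apply/esym/joined_arc/orP; left; apply/existsP; exists k.
have jl : Ordinal jm != low (letter k).1.
  by move: jlo; rewrite -lowE.
have jh : Ordinal jm != high (letter k).1.
  by move: jhi; rewrite -highE.
by rewrite !eqxx /passes /= jl jh eqxx orbT.
Qed.

Lemma braid_state_closes u : closes N (braid_state u).
Proof.
apply: funext => j; case: (ltnP j m) => [jm|mj]; last first.
  by rewrite !braid_state_outside.
rewrite -[j]/(val (Ordinal jm)) -[N in LHS]/(val (@ord_max N)).
rewrite -[0%N]/(val (@ord0 N)) !braid_stateE.
by congr u; apply/joined_arc/orP; right; rewrite /= !eqxx.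
Qed.

(** The colours of a run agree on joined segments, hence descend to arcs. *)
Lemma arcs_of_run a d (X : nat -> nat -> E) :
  evolves N position a d X -> (forall j, (j < m)%N -> X N j = X 0%N j) ->
  exists u : Defs.arc D -> E,
    (forall (k : 'I_N.+1) j, u (arc_of (k, j)) = X k j) /\
    (forall k, relation_defect a u k = d k).
Proof.
move=> XE XN.
have X_joined (x y : segment w) : joined x y -> X x.1 x.2 = X y.1 y.2.
  case/orP=> [/existsP[k /and3P[/eqP xE /eqP yE]]|/and3P[/eqP x1 /eqP y1 /eqP xy]].
    rewrite xE yE /= /passes /over_in /over_out w_pos => /orP[/andP[/eqP-> /eqP->]|].
      by rewrite XE // highE step_hi lowE.
    move=> /and3P[jlo jhi /eqP->]; rewrite XE // step_other //.
      by rewrite -lowE.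
    by rewrite -highE.
  by rewrite x1 y1 xy XN.
have X_same (x y : segment w) : same_arc x y -> X x.1 x.2 = X y.1 y.2.
  case/connectP=> p + ->; elim: p x => //= z p IHp x /andP[xz /IHp <-].
  by case/orP: xz => /X_joined.
pose u (b : Defs.arc D) := X (val b).1 (val b).2.
have uE (k : 'I_N.+1) j : u (arc_of (k, j)) = X k j.
  by have := X_same _ _ (connect_root _ (k, j)); rewrite /= => ->.
exists u; split=> // k.
have stE (n l : nat) : (n <= N)%N -> (l < m)%N -> braid_state u n l = X n l.
  rewrite -ltnS => nN lm.
  by rewrite (braid_stateE u (Ordinal nN) (Ordinal lm)) uE.
have klt := position_lt (ltn_ord k).
rewrite /relation_defect -state_lambda -state_rho -state_omega.
rewrite !stE ?ltn_ord ?(ltnW klt) ?(ltnW (ltn_ord k)) //.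
by rewrite XE // step_lo addrC addKr.
Qed.

End PositiveBraid.

(** * Conjugation as an involutive ring morphism *)

Section Conjugation.
Variables (F : finFieldType) (E : fieldExtType F).
Hypothesis E_dim : \dim {:E} = 2%N.

(** This makes the power map defining [conj] an iterate of Frobenius, hence additive. *)
Lemma card_pchar_nat : [pchar E].-nat #|{: F}|.
Proof.
have [p p_prime p_char] := finPcharP F.
have /abelian.abelem_pgroup := abelian.fin_ring_pchar_abelem p_char.
rewrite /pgroup.pgroup cardsT => /pi_pnat; apply.
by rewrite pchar_lalg.
Qed.

Lemma conjD (x y : E) : conj (x + y) = conj x + conj y.
Proof. exact: exprDn_pchar card_pchar_nat. Qed.

Lemma conjM (x y : E) : conj (x * y) = conj x * conj y.
Proof. exact: exprMn. Qed.

Lemma conjN (x : E) : conj (- x) = - conj x.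
Proof. exact: exprNn_pchar card_pchar_nat. Qed.

Lemma conj1 : conj (1 : E) = 1.
Proof. exact: expr1n. Qed.

Lemma conj0 : conj (0 : E) = 0.
Proof.
by have := conjD 0 0; rewrite addr0 => /eqP; rewrite -subr_eq subrr => /eqP <-.
Qed.

Lemma conj_relation (a b c t : E) : a - (t * b + (1 - t) * c) = 0 ->
  conj a - (conj t * conj b + (1 - conj t) * conj c) = 0.
Proof.
move=> /(congr1 (@conj F E)).
by rewrite conj0 conjD conjN conjD !conjM conjD conjN conj1.
Qed.

Lemma conjK (x : E) : conj (conj x) = x.
Proof.
have := Fermat's_little_theorem {:E}%AS x.
by rewrite memvf E_dim /conj -exprM mulnn => /esym/eqP.
Qed.

End Conjugation.

(** * The radical of [eta] for a positive closed braid *)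

Section Radical.
Variables (F : finFieldType) (E : fieldExtType F).
Hypothesis E_dim : \dim {:E} = 2%N.
Variables (theta : E) (theta_norm : theta * conj theta = 1).
Hypothesis theta_neq1 : theta != 1.
Local Notation theta_neq0 := (norm1_neq0 theta_norm).
Variables (ii : E) (ii_neq0 : ii != 0).

Lemma conj_theta : conj theta = theta^-1.
Proof. by apply: (mulfI theta_neq0); rewrite theta_norm mulfV // theta_neq0. Qed.

Section Diagram.
Variable D : diagram.
Local Notation eta := (@eta F E theta theta_neq0 ii D).

Lemma eta_linl g a f1 f2 : eta (a *: f1 + f2) g = a * eta f1 g + eta f2 g.
Proof.
rewrite /Defs.eta mulr_sumr -big_split; apply: eq_bigr => c _ /=; ring.
Qed.

Lemma eta_linr f a g1 g2 : eta f (a *: g1 + g2) = conj a * eta f g1 + eta f g2.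
Proof.
rewrite /Defs.eta mulr_sumr -big_split; apply: eq_bigr => c _ /=.
rewrite !conjD !conjM; ring.
Qed.

Lemma eta0r f : eta f 0 = 0.
Proof. by apply: big1 => c _ /=; rewrite !conj0 !mulr0 subrr mulr0. Qed.

End Diagram.

Section PositiveBraidForm.
Variables (m : nat) (w : seq ('I_m.-1 * bool)).
Hypothesis w_pos : forall k : 'I_(size w), (letter k).2.
Local Notation D := (closed_braid w).
Local Notation N := (size w).
Implicit Types f g : Rep theta_neq0 D.

Lemma extend0_0 (d : 'I_N -> E) : d =1 (fun=> 0) -> extend0 d = fun=> 0.
Proof.
move=> d0; apply: funext => k; rewrite /extend0.
by case: insubP => // c _ _; apply: d0.
Qed.

Definition rep_state f := braid_state (fun a => f (alexander_gen F a)).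
Definition conj_state g := braid_state (fun a => conj (g (alexander_gen F a))).

Lemma rep_state_evolves f : evolves N (position w) theta (fun=> 0) (rep_state f).
Proof.
rewrite -(@extend0_0 (relation_defect theta (fun a => f (alexander_gen F a)))).
  exact: braid_state_evolves.
by move=> c; apply: (rep_relation f c).
Qed.

Lemma conj_state_evolves g :
  evolves N (position w) theta^-1 (fun=> 0) (conj_state g).
Proof.
rewrite -(@extend0_0 (relation_defect theta^-1
  (fun a => conj (g (alexander_gen F a))))).
  exact: braid_state_evolves.
move=> c; have := conj_relation (rep_relation g c).
by rewrite conj_theta.
Qed.

(** All signs being positive, [eta] is [ii] times [form_ba - form_ab], and [form_abE] turns this
    into a multiple of [form_ba]. *)
Lemma eta_form f g :
  eta ii f g
  = ii * (1 - theta) * form_ba N (position w) (rep_state f) (conj_state g).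
Proof.
rewrite mulrAC -mulrA -[_ * (1 - theta)]mulrC.
have -> : (1 - theta) * form_ba N (position w) (rep_state f) (conj_state g)
  = form_ba N (position w) (rep_state f) (conj_state g)
    - form_ab N (position w) (rep_state f) (conj_state g).
  rewrite (@form_abE _ _ theta_neq0 m _ _ (position_lt (w := w)) _ _
    (rep_state_evolves f) (conj_state_evolves g)) //; first by ring.
  + exact: braid_state_closes.
  + exact: braid_state_closes.
rewrite /form_ba /form_ab -sumrB mulr_sumr; apply: eq_bigr => k _.
have oE u := state_omega w_pos (u : Defs.arc D -> E) k.
have rE u := state_rho w_pos (u : Defs.arc D -> E) k.
rewrite /rep_state /conj_state !oE !rE.
have -> : positive k by exact: w_pos.
have gapE (a b a' b' : E) :
    1 * ii * (b * a' - a * b') = ii * ((b - a) * a' - a * (b' - a')) by ring.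
exact: gapE.
Qed.

(** Conjugation exchanges the rules for [theta^-1] and [theta], so a closed run descends to the arcs
    and conjugates to a colouring. *)
Lemma rep_of_run Y : evolves N (position w) theta^-1 (fun=> 0) Y -> closes N Y ->
  exists g, forall (k : 'I_N) (j : 'I_m), conj_state g k j = Y k j.
Proof.
move=> YE YN; have [//|u [uY u_def]] := arcs_of_run w_pos YE.
  by move=> j _; rewrite YN.
pose v : {ffun Defs.arc D -> E^o} := [ffun a => conj (u a)].
have v_col : v \in colourings theta D.
  rewrite memv_ker lfunE; apply/eqP/ffunP=> c; rewrite !ffunE.
  by have := conj_relation (u_def c); rewrite -conj_theta conjK.
have [g gE] : exists g : Rep theta_neq0 D, forall a, g (alexander_gen F a) = v a.
  exists (colouring_rep theta_neq0 (vsproj (colourings theta D) v)) => a.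
  have /ffunP/(_ a) := colouring_repK theta_neq0 (vsproj (colourings theta D) v).
  by rewrite vsprojK // ffunE.
exists g => k j; rewrite /conj_state braid_state_below gE ffunE conjK //.
exact: (uY (widen_ord (leqnSn N) k) j).
Qed.

Definition gap f (k : nat) : E :=
  rep_state f k (position w k).+1 - rep_state f k (position w k).

Lemma gapE f (k : 'I_N) : gap f k
  = f (alexander_gen F (rho (d := D) k)) - f (alexander_gen F (omega (d := D) k)).
Proof. by rewrite /gap /rep_state state_omega // state_rho. Qed.

Lemma eta_eq0 f g : eta ii f g = 0 <->
  \sum_(k < N) gap f k * left_weight theta (position w) (conj_state g) k = 0.
Proof.
have fN : closes N (rep_state f) by exact: braid_state_closes.
have gN : closes N (conj_state g) by exact: braid_state_closes.
apply: iff_trans (@form_ba_eq0 _ _ theta_neq0 m _ _ (position_lt (w := w)) _ _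
  (rep_state_evolves f) (conj_state_evolves g) fN gN theta_neq1).
rewrite eta_form; split=> [/eqP|->]; last by rewrite mulr0.
by rewrite !mulf_eq0 (negPf ii_neq0) subr_eq0 eq_sym (negPf theta_neq1) => /eqP.
Qed.

(** Left weights of conjugated states lie in the left kernel, which gives one direction. For the
    other, vanishing of [eta f] lets [closed_run_exists] realize the gaps of [f] as defects of some
    [u], and left kernel vectors annihilate defects. *)
Lemma eta_radicalP f :
  (forall g, eta ii f g = 0) <->
  (forall nu, left_kernel theta nu -> \sum_c nu c *
    (f (alexander_gen F (omega (d := D) c))
     - f (alexander_gen F (rho (d := D) c))) = 0).
Proof.
have nuE (nu : 'I_N -> E) : \sum_c nu c *
    (f (alexander_gen F (omega (d := D) c)) - f (alexander_gen F (rho (d := D) c)))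
    = - \sum_c nu c * gap f c.
  by rewrite -sumrN; apply: eq_bigr => c _; rewrite -mulrN gapE opprB.
split=> [f_rad nu nu_ker|f_ker g]; last first.
  apply/eta_eq0.
  pose nu (c : 'I_N) := left_weight theta (position w) (conj_state g) c.
  transitivity (- - \sum_c nu c * gap f c).
    by rewrite opprK; apply: eq_bigr => c _; rewrite mulrC.
  rewrite -nuE f_ker ?oppr0 // => u.
  (* Both states close up, so the initial and final pairings cancel. *)
  have := pairing_evolves theta_neq0 (position_lt (w := w)) (leqnn N)
    (braid_state_evolves w_pos theta u) (conj_state_evolves g).
  rewrite (braid_state_closes u : _ N = _).
  have -> : conj_state g N = conj_state g 0%N by exact: braid_state_closes.
  move=> /eqP; rewrite -subr_eq0 opprD addNKr oppr_eq0 => /eqP sum0.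
  rewrite -[RHS]sum0; apply: eq_bigr => c _.
  by rewrite extend0E mulrC.
rewrite nuE; have [|X [XE XN]] := @closed_run_exists _ theta theta_neq0 m N
  (position w) (position_lt (w := w)) (gap f).
  move=> Y YE YN; have [g gY] := rep_of_run YE YN.
  have XfN : closes N (rep_state f) by exact: braid_state_closes.
  apply/(@form_ba_eq0 _ _ theta_neq0 m _ _ (position_lt (w := w)) _ _
    (rep_state_evolves f) YE XfN YN theta_neq1).
  have /eqP := f_rad g; rewrite eta_form mulf_eq0 mulf_eq0 (negPf ii_neq0).
  rewrite subr_eq0 eq_sym (negPf theta_neq1) => /eqP ba0; rewrite -[RHS]ba0.
  by apply: eq_bigr => k _; rewrite -lowE gY.
have [u [_ u_def]] := arcs_of_run w_pos XE XN.
have u0 := nu_ker u; apply/eqP; rewrite oppr_eq0 -[X in _ == X]u0; apply/eqP.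
by apply: eq_bigr => c _; rewrite -u_def.
Qed.

End PositiveBraidForm.
End Radical.

(** * The rank of [eta] for positive closed braids and torus links *)

Lemma alexander_spanned (F : fieldType) (D : diagram)
    (x : alexander_module F D) :
  spanned (fun i : 'I_#|Defs.arc D| => alexander_gen F (enum_val i)) x.
Proof.
exists (fun i => (repr x : {ffun Defs.arc D -> (laurent F)^o}) (enum_val i)).
rewrite -{1}(span_piK x); set X : {ffun Defs.arc D -> (laurent F)^o} := repr x.
have {1}-> : X = \sum_a (X a : laurent F) *: free_gen F a.
  apply/ffunP=> b; rewrite sum_ffunE.
  under eq_bigr do rewrite !ffunE /GRing.scale /= mulrC eq_sym.
  by rewrite (sum_delta b X).
rewrite linear_sum (reindex_onto enum_val enum_rank) => [|a _]; last first.
  exact: enum_rankK.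
rewrite (eq_bigl predT) => [|i]; last by rewrite enum_valK eqxx.
by apply: eq_bigr => i _; rewrite linearZ.
Qed.

(** The functionals fed to [form_rankE] are the evaluations at the torsion elements [e i] of
    [torsion_dual]. Their common zeros are the homomorphisms killing the [h]-torsion, which
    [kills_torsionP] and [eta_radicalP] identify with the radical. *)
Theorem positive_braid_rank (F : finFieldType) (E : fieldExtType F)
    (E_dim : \dim {:E} = 2%N) (theta : E)
    (theta_gen : <<1; theta>>%VS = {:E}%VS)
    (theta_norm : theta * conj theta = 1) (h : {poly F})
    (theta_min : minPoly 1 theta = map_poly (in_alg E) h)
    (h_sep : (map_poly (in_alg E) h^`()).[theta] != 0)
    (ii : E) (ii_neq0 : ii != 0) (m : nat) (w : seq ('I_m.-1 * bool)) :
  (forall k : 'I_(size w), (letter k).2) ->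
  form_rank (@eta F E theta (norm1_neq0 theta_norm) ii (closed_braid w))
  = nu' h (closed_braid w).
Proof.
move=> w_pos; set t0 := norm1_neq0 theta_norm; set D := closed_braid w.
have theta_neq1 : theta != 1.
  apply: contra_eq_neq E_dim => theta1; rewrite -theta_gen theta1.
  by rewrite (Fadjoin_idP (mem1v 1%AS)) dimv1.
have ev_eq0 := laurent_eval_eq0 t0 theta_min.
have ev_surj := laurent_eval_surj t0 theta_gen.
have h0 : laurent_of_poly h <> 0.
  move=> h0; have : map_poly (in_alg E) h != 0.
    by rewrite -theta_min monic_neq0 ?monic_minPoly.
  rewrite -(rmorph0 (@laurent_of_poly F)) in h0.
  by rewrite (laurent_of_poly_inj h0) map_poly0 eqxx.
have [I [e [Ik he e_sep e_surj]]] := torsion_dual_multiplicity h0 ev_eq0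
  (@alexander_spanned F D).
rewrite /nu' -Ik.
apply: (@form_rankE E _ _ (@conj F E) _ _ _ I (fun i f => rep_fun f (e i))).
- by move=> g a f1 f2; apply: eta_linl.
- by move=> f a g1 g2; apply: eta_linr.
- exact: eta0r.
- by [].
- move=> c; have [f [fL fe]] := e_surj c.
  by exists (rep_of fL).
move=> f; split=> [/(eta_radicalP E_dim theta_neq1 ii_neq0 w_pos) f_ker i|fe].
  have := (kills_torsionP ev_surj ev_eq0 _ f).2; apply=> //.
  by rewrite laurent_eval_poly.
apply/(eta_radicalP E_dim theta_neq1 ii_neq0 w_pos).
apply: (kills_torsionP ev_surj ev_eq0 _ f).1; first by rewrite laurent_eval_poly.
exact: e_sep (rep_linear f) fe.
Qed.

Lemma torus_word_positive m n k : (letter (w := torus_word m n) k).2.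
Proof.
have : letter k \in torus_word m n by apply: mem_tnth.
by case/flattenP=> s /nseqP[-> _] /mapP[i _ ->].
Qed.

(* If 2 theta + kappa = 0, then theta ^ 2 = 1, so theta lies in F. *)
Lemma quadratic_separable (F : fieldType) (E : fieldExtType F) (theta : E)
    (kappa : F) :
  minPoly 1 theta = map_poly (in_alg E) ('X^2 + kappa *: 'X + 1) ->
  theta \notin 1%VS ->
  (map_poly (in_alg E) ('X^2 + kappa *: 'X + 1)^`()).[theta] != 0.
Proof.
rewrite -mul_polyC => theta_min; apply: contra => /eqP.
have hE : ('X^2 + kappa%:P * 'X + 1)^`() = 'X *+ 2 + kappa%:P.
  rewrite derivD derivD derivM derivX derivC derivXn derivC.
  by rewrite mul0r add0r mulr1 addr0.
rewrite hE rmorphD rmorphMn /= map_polyX map_polyC hornerD hornerMn hornerX hornerC.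
move=> th2; have : (minPoly 1 theta).[theta] = 0 by rewrite minPolyxx.
rewrite theta_min !rmorphD !rmorphM /= map_polyX map_polyC rmorph1.
rewrite !hornerE.
move: (_ kappa) th2 => k th2 th0.
have : (theta - 1) * (theta + 1) = 0.
  transitivity ((theta *+ 2 + k) * theta - (theta * theta + k * theta + 1)).
    by rewrite mulr2n; ring.
  by rewrite th2 th0 mul0r subrr.
move/eqP; rewrite mulf_eq0 subr_eq0 addr_eq0 => /orP[]/eqP->.
  exact: mem1v.
by rewrite memvN mem1v.
Qed.

Theorem theorem4p5 (p : nat) (p_prime : prime p)
    (E : fieldExtType 'F_p) (E_dim : \dim {:E} = 2%N)
    (theta : E) (theta_gen : <<1; theta>>%VS = {:E}%VS)
    (theta_norm : theta * conj theta = 1)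
    (kappa : 'F_p)
    (theta_min :
       minPoly 1 theta = map_poly (in_alg E) ('X^2 + kappa *: 'X + 1))
    (q : nat) (q_order : q.-primitive_root theta)
    (ii : E) (ii_neq0 : ii != 0) (ii_conj : conj ii = - ii)
    (m n : nat) (m_gt0 : (0 < m)%N) (n_gt0 : (0 < n)%N)
    (c : nat) (c_gcd : c = gcdn m n) :
  ~ [/\ (q %| m * n %/ c)%N, ~~ (p %| m * n)%N & (4 %| mult_order c p)%N] ->
  form_rank (@eta 'F_p E theta (norm1_neq0 theta_norm) ii (torus_link m n))
  = nu' ('X^2 + kappa *: 'X + 1 : {poly 'F_p}) (torus_link m n).
Proof.
move=> _; apply: positive_braid_rank => //.
  apply: quadratic_separable theta_min _; apply/negP => theta1.
  by move: E_dim; rewrite -theta_gen (Fadjoin_idP theta1) dimv1.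
exact: torus_word_positive.
Qed.
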